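(* Assume $N\le n^2$ and let $CB_*(\hat\theta,r_\alpha)=\{\theta:\|\theta-\hat\theta\|_2\le r_\alpha\}$ be the confidence ball defined in the context. Then $$\inf_{\theta\in\mathbb{R}^N}P_\theta\left(\theta\in CB_*(\hat\theta,r_\alpha)\right)\ \ge\ 1-\alpha-2(\log n)^{-1}$$ and, if $M\ge1$, $$\sup_{\theta\in B_{p,q}^\tau(M)}E_\theta(r_\alpha^2)\ \le\ \left[2\log^{1/2}\left(\tfrac2\alpha\right)+4\lambda_*^{1/2}z_{\alpha/2}+4\right]N^{1/2}n^{-1}+C_\tau\min\left(Nn^{-1},\ M^{2/(1+2\tau)}n^{-2\tau/(1+2\tau)}\right),$$ where $C_\tau>0$ is a constant depending only on $\tau$.
   Context: Model: one observes $y_{j,k}=\theta_{j,k}+\frac{1}{\sqrt n}z_{j,k}$, $j=0,1,\dots,J-1$, $k=1,\dots,2^j$, with $z_{j,k}$ i.i.d. $N(0,1)$, $n>1$, where $2^J-1=N$ is the total number of coordinates, so $\theta=(\theta_{j,k})\in\mathbb{R}^N$. $P_\theta,E_\theta$ denote probability and expectation under $\theta$. Besov body: for $\tau>0$, $p\ge2$, $q\ge1$, $M>0$ and $s=\tau+\frac12-\frac1p>0$, $$B_{p,q}^{\tau}(M)=\left\{\theta:\left(\sum_{j=0}^{J-1}\left(2^{js}\Big(\sum_{k=1}^{2^j}|\theta_{j,k}|^p\Big)^{1/p}\right)^q\right)^{1/q}\le M\right\}.$$ $z_\alpha=\Phi^{-1}(1-\alpha)$, $\Phi$ the standard normal cumulative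 distribution function; $0<\alpha<1$; $\log^{1/2}(x)=(\log x)^{1/2}$; $(x)_+=\max(0,x)$. $\lambda_*=6.9368\ldots$ is the root greater than $1$ of $\lambda-\log\lambda=5$. Blocks: $L=\log n$, and at each level $j$ the indices are grouped into blocks of size $L$, $B_i^j=\{(j,k):(i-1)L+1\le k\le iL\}$, $1\le i\le2^j/L$. Rounding is ignored: $L$ is treated as an integer, each block is treated as having exactly $L$ indices, and all observations are treated as belonging to such blocks. Set $S_{j,i}^2=\sum_{(j,k)\in B_i^j}y_{j,k}^2$. Center: $\hat\theta=(\hat\theta_{j,k})$ with $\hat\theta_{j,k}=y_{j,k}\cdot I(S_{j,i}^2\ge\lambda_*Ln^{-1})$ for $(j,k)\in B_i^j$, all levels $j$. Squared radius: $$r_\alpha^2=\left[2\log^{1/2}\left(\tfrac2\alpha\right)+4\lambda_*^{1/2}z_{\alpha/2}\right]N^{1/2}n^{-1}+\sum_{j=0}^{J-1}\left(\sum_i(S_{j,i}^2-Ln^{-1})I(S_{j,i}^2\le\lambda_*Ln^{-1})\right)_+ +(2\lambda_*+8\lambda_*^{1/2}-1)Ln^{-1}\,\mathrm{Card}\{(j,i):S_{j,i}^2>\lambda_*Ln^{-1}\}.$$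
   Formalization: Rounding made consistent: L is log n rounded up to an integer; level j has, instead of exactly 2^j coordinates, any neighbouring multiple of L (2^j itself if L divides it); N is the resulting total number of coordinates instead of 2^J-1. *)

(* Defs.v *)
From HB Require Import structures.
From mathcomp Require Import all_boot all_order all_algebra.
From mathcomp Require Import all_classical all_reals all_analysis.

Set Implicit Arguments.
Unset Strict Implicit.
Unset Printing Implicit Defensive.

Import Order.TTheory GRing.Theory Num.Theory.
Import numFieldNormedType.Exports.

Local Open Scope classical_set_scope.
Local Open Scope ring_scope.

(* Indices are 0-based: the levels are j < J, and the coordinates of level j
   are k < d j. The level size d j stands for 2 ^ j, see [dyadic_sizes]. *)

Definition coord_idx (J : nat) (d : nat -> nat) := {j : 'I_J & 'I_(d j)}.

Definition at_level (J : nat) (d : nat -> nat) (j : 'I_J) (k : 'I_(d j)) :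
  coord_idx J d := Tagged (fun j : 'I_J => 'I_(d j)) k.

(* N, the number of coordinates; it is 2 ^ J - 1 when d j = 2 ^ j. *)
Definition ncoord (J : nat) (d : nat -> nat) : nat := (\sum_(j < J) d j)%N.

(* The block size is log n, rounded up to an integer; it is exactly log n when
   log n is an integer. *)
Definition blocksize (R : realType) (n : R) : nat := `|Num.ceil (ln n)|%N.

(* If every block has exactly L indices and every coordinate lies in a block,
   then L divides the size of each level, which excludes the size 2 ^ j in
   general. The size of level j is therefore 2 ^ j rounded, down or up, to one
   of the two neighbouring multiples of L (2 ^ j itself if L divides it). *)
Definition dyadic_sizes (J : nat) (L : nat) (d : nat -> nat) : Prop :=
  forall j, (j < J)%N ->
    [/\ (L %| d j)%N, (d j < 2 ^ j + L)%N & (2 ^ j < d j + L)%N].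

(* Product rule for a finite family; subfamilies are covered by taking some of
   the A i to be setT. *)
Definition mutually_independent d (T : measurableType d) (R : realType)
    (P : probability T R) (I : finType) (X : I -> {RV P >-> R}) : Prop :=
  forall A : I -> set R, (forall i, measurable (A i)) ->
    P (\bigcap_(i in [set: I]) (X i @^-1` A i))
    = (\prod_(i : I) P (X i @^-1` A i))%E.

Definition iid_std_normal d (T : measurableType d) (R : realType)
    (P : probability T R) (I : finType) (z : I -> {RV P >-> R}) : Prop :=
  (forall (i : I) (A : set R), measurable A ->
     distribution P (z i) A = normal_prob 0 1 A)
  /\ mutually_independent z.

(* P_theta is the law of [obs n theta z] when z is i.i.d. standard normal. *)
Definition obs (T : Type) (R : realType) (I : Type) (n : R) (theta : I -> R)
    (z : I -> T -> R) (w : T) : I -> R :=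
  fun x => theta x + z x w / Num.sqrt n.

Definition Phi (R : realType) (x : R) : R := fine (normal_prob 0 1 `]-oo, x]).

(* z_a, the unique x with Phi x = 1 - a (0 is a junk value) *)
Definition normal_upper (R : realType) (a : R) : R :=
  xget 0 [set x : R | Phi x = 1 - a].

(* lambda_* = 6.9368..., the unique root greater than 1 (0 is a junk value) *)
Definition lambda_star (R : realType) : R :=
  xget 0 [set x : R | 1 < x /\ x - ln x = 5].

Definition besov (R : realType) (J : nat) (d : nat -> nat) (tau p q M : R) :
    set (coord_idx J d -> R) :=
  let s := tau + 1 / 2 - 1 / p in
  [set theta |
    (\sum_(j < J)
       (2 `^ (j%:R * s)
        * (\sum_(k < d j) `|theta (at_level k)| `^ p) `^ (1 / p)) `^ q)
      `^ (1 / q) <= M].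

Definition l2norm (R : realType) (I : finType) (v : I -> R) : R :=
  Num.sqrt (\sum_(x : I) v x ^+ 2).

(* S_{j,i}^2; the i-th block of level j is {k : k %/ L = i}, i < d j %/ L. *)
Definition S2 (R : realType) (J : nat) (d : nat -> nat) (L : nat)
    (y : coord_idx J d -> R) (j : 'I_J) (i : nat) : R :=
  \sum_(k < d j | (k %/ L == i)%N) y (at_level k) ^+ 2.

Definition theta_hat (R : realType) (J : nat) (d : nat -> nat) (n : R)
    (y : coord_idx J d -> R) : coord_idx J d -> R :=
  let L := blocksize n in
  fun x => y x *
    (lambda_star R * L%:R / n <= S2 L y (tag x) (tagged x %/ L)%N)%R%:R.

Definition kept_blocks (R : realType) (J : nat) (d : nat -> nat) (n : R)
    (y : coord_idx J d -> R) : nat :=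
  let L := blocksize n in
  #|[pred b : {j : 'I_J & 'I_(d j %/ L)}
      | lambda_star R * L%:R / n < S2 L y (tag b) (tagged b)]|.

Definition radius2 (R : realType) (J : nat) (d : nat -> nat) (n alpha : R)
    (y : coord_idx J d -> R) : R :=
  let L := blocksize n in
  let lam := lambda_star R in
  (2 * Num.sqrt (ln (2 / alpha)) + 4 * Num.sqrt lam * normal_upper (alpha / 2))
    * Num.sqrt (ncoord J d)%:R / n
  + \sum_(j < J)
      Num.max 0 (\sum_(i < d j %/ L)
        (S2 L y j i - L%:R / n) * (S2 L y j i <= lam * L%:R / n)%R%:R)
  + (2 * lam + 8 * Num.sqrt lam - 1) * L%:R / n * (kept_blocks n y)%:R.

Definition confidence_ball (R : realType) (J : nat) (d : nat -> nat)
    (n alpha : R) (y : coord_idx J d -> R) : set (coord_idx J d -> R) :=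
  [set theta | l2norm (fun x => theta x - theta_hat n y x)
               <= Num.sqrt (radius2 n alpha y)].

(* Main.v *)
Require Import Defs.
From HB Require Import structures.
From mathcomp Require Import all_boot all_order all_algebra.
From mathcomp Require Import all_classical all_reals all_analysis.
From mathcomp Require Import measurable_realfun.
From mathcomp Require Import ring lra zify.

Set Implicit Arguments.
Unset Strict Implicit.
Unset Printing Implicit Defensive.

Import Order.TTheory GRing.Theory Num.Theory.
Import numFieldNormedType.Exports.

Local Open Scope classical_set_scope.
Local Open Scope ring_scope.

(** Write v = sqrt n * theta, so that sqrt n * y = v + z. On a block with L
    coordinates let s, xi, m, chi be the sums of (v + z)^2, v^2, v z and z^2,
    hence s = xi + 2 m + chi. The loss of the estimator on that block, times n,
    is chi if the block is kept (s >= lambda L) and xi if it is killed.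

    Coverage. Call a block small when xi <= 4 lambda L, and suppose that every
    block has chi <= lambda L and every small block has m <= 4 sqrt(lambda) L.
    Then a kept block loses at most what the radius charges for it, up to the
    credit 2 (- m) + (L - chi) if it is small, and a killed block is
    automatically small, because xi <= 2 s + 2 chi, with loss exactly
    s - L + 2 (- m) + (L - chi) ([block_loss_le]). Summing over blocks
    ([confidence_ballP]), coverage is reduced to two fluctuations over the
    deterministic set of small blocks: the sum of - v z is centred Gaussian with
    variance at most 4 lambda N, so that the normal quantile controls it
    ([gaussian_sum_quantile]), and the sum of 1 - z^2 obeys a lower chi-square
    bound ([chi2_lower_tail]). Each fails with probability at most alpha / 2.
    The two block conditions fail with probability at most exp(-2 L) <= n^-2 per
    block; this is what the equation lambda - log lambda = 5 is for
    ([noncentral_chi2_tail]). Since there are N / L <= n^2 / log n blocks, the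
    union bound costs 2 / log n ([coverage_ge]).

    Radius. Let Q = n * M^(2/(1+2 tau)) * n^(-2 tau/(1+2 tau)), the size of a
    level at which the noise Q / n equals the energy M^2 Q^(-2 tau) left in a
    Besov body. Levels of size about at most Q contribute at most a constant
    times their size over n. At a higher level of size D, the positive part in
    the radius has expectation at most sqrt D / n plus a multiple of the energy
    of theta there, because x_+ <= (x + a)^2 / (4 a) with a = 2 sqrt D
    ([integral_score_max_le]); and a block is kept with probability at most
    exp(-2 L) plus a multiple of xi / L, so that the charge for kept blocks is
    again bounded by the energy of theta, up to a remainder of order
    exp(-2 L) N / n <= Q / n ([expected_radius2_le]). The sizes grow
    geometrically, so the sqrt D add up to at most 4 sqrt N
    ([sum_sqrt_levels]), which is the extra 4 in the bound, while the energies
    decay like 2^(-2 j tau) and add up to a multiple of the rate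
    ([besov_high_energy]). If there is any high level then N >= Q / 2, which
    gives the minimum with N / n. Rounding the level sizes to multiples of L
    only matters for levels shorter than 16 L: their total size is of order
    (log n)^2, which is at most a constant depending on tau times Q
    ([sqr_log_le]).

    The probabilistic input is derived from one fact: for independent variables
    the pair formed by one of them and a sum of functions of others has a
    product law ([indep_pairP]). Induction on the number of summands then gives
    exponential moments, second moments, absence of atoms and the exact normal
    law of linear combinations. *)

Lemma le_of_eq (disp : Order.disp_t) (T : porderType disp) (x y : T) :
  x = y -> (x <= y)%O.
Proof. by move=> ->. Qed.

(** * Lebesgue measure under affine maps *)

Section affine.
Variable R : realType.
Notation mu := (@lebesgue_measure R).

Lemma measurable_affine (c b : R) : measurable_fun setT (fun x : R => c * x + b).
Proof. by apply: measurable_funD => //; exact: measurable_funM. Qed.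

Lemma affine_preimage_oc (c b x y : R) : 0 < c ->
  (fun u : R => c * u + b) @^-1` `]x, y] = `](x - b) / c, (y - b) / c]%classic.
Proof.
move=> c0; apply/seteqP; split => u /=; rewrite !in_itv/= => /andP[h1 h2];
  apply/andP; split.
- by rewrite ltr_pdivrMr//; lra.
- by rewrite ler_pdivlMr//; lra.
- by move: h1; rewrite ltr_pdivrMr//; lra.
- by move: h2; rewrite ler_pdivlMr//; lra.
Qed.

Lemma lebesgue_measure_affine_pos (c b : R) (A : set R) : 0 < c -> measurable A ->
  (c%:E * mu ((fun x : R => (c * x + b)%R) @^-1` A) = mu A)%E.
Proof.
move=> c0 mA.
pose cn : {nonneg R} := NngNum (ltW c0).
pose f : measurableTypeR R -> measurableTypeR R := fun x => c * x + b.
have mf : measurable_fun setT f := measurable_affine c b.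
apply/esym.
rewrite (@lebesgue_measure_unique R
  (mscale cn (pushforward mu f)))//= => _ [[x y]] _ <- /=.
rewrite /mscale/= /pushforward affine_preimage_oc//.
rewrite !lebesgue_measure_itv/= !lte_fin ltr_pM2r ?invr_gt0// ltrBlDr subrK.
case: ifP => _; last by rewrite mule0.
rewrite -!EFinB -EFinM; congr (_%:E); field; exact: lt0r_neq0.
Qed.

(** Reduced to c > 0 by the invariance of Lebesgue measure under x |-> - x. *)
Lemma lebesgue_measure_affine (c b : R) (A : set R) : c != 0 -> measurable A ->
  (`|c|%:E * mu ((fun x : R => (c * x + b)%R) @^-1` A) = mu A)%E.
Proof.
move=> c0 mA; have [cp|cn] := ltP 0 c.
  by rewrite gtr0_norm//; exact: lebesgue_measure_affine_pos.
have {c0}cn : 0 < - c by rewrite oppr_gt0 lt_neqAle c0.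
rewrite ltr0_norm -?oppr_gt0// -[RHS](lebesgue_measure_affine_pos b cn mA).
congr (_ * _)%E; rewrite -[RHS]lebesgue_measureN; last first.
  by rewrite -[X in measurable X]setTI; exact: measurable_affine.
by rewrite /pushforward; congr (mu _); apply/seteqP; split => x /=; rewrite mulrNN.
Qed.

Lemma ge0_integral_affine (c b : R) (f : R -> \bar R) : c != 0 ->
  measurable_fun setT f -> (forall x, 0 <= f x)%E ->
  (`|c|%:E * \int[mu]_x f (c * x + b)%R = \int[mu]_x f x)%E.
Proof.
move=> c0 mf f0.
pose cn : {nonneg R} := NngNum (normr_ge0 c).
pose h : measurableTypeR R -> measurableTypeR R := fun x => c * x + b.
have mh : measurable_fun setT h := measurable_affine c b.
pose nu : {measure set (measurableTypeR R) -> \bar R} :=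
  mscale cn (pushforward mu h).
transitivity (\int[nu mh]_x f x)%E.
  by rewrite ge0_integral_mscale//= ge0_integral_pushforward.
apply: eq_measure_integral => A mA _.
by rewrite /mscale/= /pushforward; exact: lebesgue_measure_affine.
Qed.
End affine.

(** * Normal laws: densities and affine images *)

Section gauss.
Variable R : realType.
Notation mu := (@lebesgue_measure R).
Implicit Types (m s c b : R).

Lemma measurable_normal_pdfE m s :
  measurable_fun setT (fun x : R => (normal_pdf m s x)%:E).
Proof. by apply/measurable_EFinP; exact: measurable_normal_pdf. Qed.

(** The Radon-Nikodym derivative of the normal law agrees almost everywhere with
    the density, since both have the same integrals on measurable sets. *)
Lemma ge0_integral_normal_prob m s (f : R -> \bar R) :
  measurable_fun setT f -> (forall x, 0 <= f x)%E ->
  (\int[normal_prob m s]_x f x = \int[mu]_x (f x * (normal_pdf m s x)%:E))%E.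
Proof.
move=> mf f0.
have dom : (normal_prob m s : set (measurableTypeR R) -> \bar R) `<< mu :=
  normal_prob_dominates m s.
rewrite -(Radon_Nikodym_SigmaFinite.change_of_variables dom)//=.
apply: ae_eq_integral => //.
- apply: emeasurable_funM => //; apply: (measurable_int mu).
  exact: Radon_Nikodym_SigmaFinite.f_integrable.
- apply: emeasurable_funM; first exact: mf.
  exact: measurable_normal_pdfE.
- apply: ae_eqe_mul2l => /=; apply: integral_ae_eq => //=.
  + exact: Radon_Nikodym_SigmaFinite.f_integrable.
  + exact: measurable_normal_pdfE.
  + by move=> A _ mA; rewrite -Radon_Nikodym_SigmaFinite.f_integral.
Qed.

Lemma normal_pdf_affine c b x : c != 0 ->
  normal_pdf 0 1 x = `|c| * normal_pdf b `|c| (c * x + b).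
Proof.
move=> c0; have nc0 : `|c| != 0 by rewrite normr_eq0.
rewrite !normal_pdfE ?oner_eq0// /normal_peak /normal_fun mulrA; congr (_ * expR _).
  rewrite expr1n mul1r -mulrnAr sqrtrM ?sqr_ge0// sqrtr_sqr normr_id.
  by rewrite invfM mulrA divff// mul1r.
rewrite real_normK ?num_real//; field.
exact: c0.
Qed.

Lemma normal_prob_affine c b (A : set R) : c != 0 -> measurable A ->
  normal_prob 0 1 ((fun x => c * x + b) @^-1` A) = normal_prob b `|c| A.
Proof.
move=> c0 mA; rewrite /normal_prob.
set g := (fun x => (normal_pdf b `|c| x)%:E) \_ A.
have mg : measurable_fun setT g.
  apply: (measurable_restrictT _ mA).1; apply: measurable_funTS.
  exact: measurable_normal_pdfE.
have g0 x : (0 <= g x)%E.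
  by rewrite /g patchE; case: ifP => // _; rewrite lee_fin normal_pdf_ge0.
rewrite integral_mkcond [RHS]integral_mkcond -/g.
rewrite -[RHS](ge0_integral_affine b c0 mg g0) -ge0_integralZl//; last first.
  by apply: measurableT_comp; [exact: mg|exact: measurable_affine].
apply: eq_integral => x _; rewrite /g !patchE.
have -> : (x \in (fun x => c * x + b) @^-1` A) = (c * x + b \in A).
  by apply/idP/idP; rewrite !inE.
case: ifP => _; last by rewrite mule0.
by rewrite -EFinM (normal_pdf_affine b _ c0).
Qed.
End gauss.

(** * Moments of the standard normal law *)

Section moments.
Variable R : realType.
Notation mu := (@lebesgue_measure R).
Notation N01 := (normal_prob (0 : R) 1).

(** Completing the square turns exp(a u + b u^2) times the standard density into
    a constant times the density with mean a / (1 - 2 b) and variance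
    1 / (1 - 2 b), whose integral is 1. Every tail bound and every moment below
    comes from this Laplace transform. *)
Lemma integral_normal_expR_quad (a b : R) : b < 1 / 2 ->
  (\int[N01]_u (expR (a * u + b * u ^+ 2))%:E =
   ((Num.sqrt (1 - 2 * b))^-1 * expR (a ^+ 2 / (2 * (1 - 2 * b))))%:E)%E.
Proof.
move=> b12; have k0 : 0 < 1 - 2 * b by lra.
set k := 1 - 2 * b in k0 *.
have sk0 : 0 < Num.sqrt k by rewrite sqrtr_gt0.
set s := (Num.sqrt k)^-1.
have s0 : s != 0 by rewrite invr_eq0 gt_eqF.
rewrite ge0_integral_normal_prob; last 2 first.
- apply/measurable_EFinP/measurableT_comp => //.
  by apply: measurable_funD; exact: measurable_funM.
- by move=> x; rewrite lee_fin expR_ge0.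
set K := s * _.
have K0 : 0 <= K by rewrite mulr_ge0 ?expR_ge0// invr_ge0 ltW.
transitivity (\int[mu]_u (K%:E * (normal_pdf (a / k) s u)%:E))%E; last first.
  rewrite ge0_integralZl//.
  - by rewrite integral_normal_pdf mule1.
  - exact: measurable_normal_pdfE.
  - by move=> x _; rewrite lee_fin normal_pdf_ge0.
apply: eq_integral => u _; rewrite -!EFinM; congr EFin.
rewrite !normal_pdfE ?oner_eq0// /normal_peak /normal_fun /K.
have -> : s ^+ 2 = k^-1 by rewrite /s exprVn sqr_sqrtr// ltW.
have -> : Num.sqrt (k^-1 * pi *+ 2) = s * Num.sqrt (1 ^+ 2 * pi *+ 2).
  by rewrite expr1n mul1r -mulrnAr sqrtrM ?invr_ge0 1?ltW// sqrtrV// ltW.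
set q := Num.sqrt _; rewrite mulrCA -expRD.
transitivity (q^-1 * expR (a ^+ 2 / (2 * k) + - (u - a / k) ^+ 2 / (k^-1 *+ 2))).
  congr (_ * expR _); rewrite /k; field.
  by rewrite gt_eqF.
rewrite expRD (invfM s); move: (q^-1) (expR _) (expR _) => r e1 e2; field.
exact: s0.
Qed.

(** Squaring reduces numerical bounds on inverse square roots to polynomial
    inequalities. *)
Lemma invr_sqrt_le (k y : R) : 0 < k -> 0 <= y -> 1 <= y ^+ 2 * k ->
  (Num.sqrt k)^-1 <= y.
Proof.
move=> k0 y0 h; have sk : 0 < Num.sqrt k by rewrite sqrtr_gt0.
rewrite -div1r ler_pdivrMr//.
rewrite -ler_sqr ?nnegrE ?mulr_ge0 ?(ltW sk)//.
by rewrite expr1n exprMn sqr_sqrtr// ltW.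
Qed.

Lemma invr_sqrt_up (t : R) : 0 < t <= 1 / 4 ->
  (Num.sqrt (1 - 2 * t))^-1 <= 1 + t + 6 * t ^+ 2.
Proof.
move=> /andP[t0 t4]; apply: invr_sqrt_le; [lra|by have := sqr_ge0 t; lra|].
have -> : (1 + t + 6 * t ^+ 2) ^+ 2 * (1 - 2 * t) =
  1 + t ^+ 2 * (9 - 14 * t + 12 * t ^+ 2 - 72 * t ^+ 3) by ring.
rewrite lerDl mulr_ge0 ?sqr_ge0//.
have : t ^+ 3 <= (1 / 4) ^+ 3 by rewrite lerXn2r ?nnegrE ?(ltW t0)//; lra.
by have := sqr_ge0 t; lra.
Qed.

Lemma invr_sqrt_lo (t : R) : 0 < t <= 1 / 4 ->
  (Num.sqrt (1 + 2 * t))^-1 <= 1 - t + 3 / 2 * t ^+ 2.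
Proof.
move=> /andP[t0 t4]; apply: invr_sqrt_le; [lra|by have := sqr_ge0 t; lra|].
have -> : (1 - t + 3 / 2 * t ^+ 2) ^+ 2 * (1 + 2 * t) =
  1 + t ^+ 3 * (5 - 15 / 4 * t + 9 / 2 * t ^+ 2) by field.
by rewrite lerDl mulr_ge0 ?exprn_ge0 ?(ltW t0)//; have := sqr_ge0 t; lra.
Qed.

Lemma measurable_EFin_pow n : measurable_fun setT (fun u : R => (u ^+ n)%:E).
Proof. by apply/measurable_EFinP. Qed.

Lemma integral_normal_expR_sqr (b : R) : b < 1 / 2 ->
  (\int[N01]_u (expR (b * u ^+ 2))%:E = ((Num.sqrt (1 - 2 * b))^-1)%:E)%E.
Proof.
move=> b12; have := integral_normal_expR_quad 0 b12.
rewrite expr0n mul0r expR0 mulr1 => <-.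
by apply: eq_integral => u _; rewrite mul0r add0r.
Qed.

Lemma integral_normal_cst (c : R) : (\int[N01]_u c%:E = c%:E)%E.
Proof.
rewrite integral_cst// -[RHS]mule1; congr (_ * _)%E.
exact: (@probability_setT _ _ _ (normal_prob (0 : R) 1)).
Qed.

(** Integrating 1 + t u^2 <= exp(t u^2) and 1 <= exp(- t u^2) + t u^2 against the
    standard normal law gives, by the explicit Laplace transforms, an error of
    order t^2 on t times the second moment; letting t tend to 0 pins it to 1. *)
Lemma integral_normal_sqr : (\int[N01]_u (u ^+ 2)%:E = 1)%E.
Proof.
set m := (\int[N01]_u _)%E.
have m0 : (0 <= m)%E by apply: integral_ge0 => u _; rewrite lee_fin sqr_ge0.
have mt (t : R) : 0 <= t -> (\int[N01]_u (1 + t * u ^+ 2)%:E = 1 + t%:E * m)%E.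
  move=> t0; under eq_integral do rewrite EFinD EFinM.
  rewrite ge0_integralD//; last 2 first.
  - by move=> u _; rewrite -EFinM lee_fin mulr_ge0// sqr_ge0.
  - by apply/measurable_EFinP; exact: measurable_funM.
  rewrite integral_normal_cst ge0_integralZl//.
  - exact: measurable_EFin_pow.
  - by move=> u _; rewrite lee_fin sqr_ge0.
have up (t : R) : 0 < t <= 1 / 4 -> (1 + t%:E * m <= (1 + t + 6 * t ^+ 2)%:E)%E.
  move=> /andP[t0 t4]; rewrite -mt ?(ltW t0)//.
  apply: (@le_trans _ _ (\int[N01]_u (expR (t * u ^+ 2))%:E)%E).
    apply: ge0_le_integral => //.
    - by move=> u _; rewrite lee_fin addr_ge0// mulr_ge0 ?sqr_ge0 ?(ltW t0).
    - apply/measurable_EFinP; apply: measurable_funD => //.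
      exact: measurable_funM.
    - apply/measurable_EFinP; apply: measurableT_comp => //.
      exact: measurable_funM.
    - by move=> u _; rewrite lee_fin expR_ge1Dx.
  rewrite integral_normal_expR_sqr; last lra.
  by rewrite lee_fin invr_sqrt_up// t0 t4.
have lo (t : R) : 0 < t <= 1 / 4 -> (1 <= (1 - t + 3 / 2 * t ^+ 2)%:E + t%:E * m)%E.
  move=> /andP[t0 t4]; rewrite -[X in (X <= _)%E](integral_normal_cst 1).
  apply: (@le_trans _ _ (\int[N01]_u ((expR (- t * u ^+ 2))%:E + t%:E * (u ^+ 2)%:E))%E).
    apply: ge0_le_integral => //.
    - apply: emeasurable_funD.
        apply/measurable_EFinP; apply: measurableT_comp => //.
        exact: measurable_funM.
      by apply/measurable_EFinP; exact: measurable_funM.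
    - move=> u _; rewrite -EFinM -EFinD lee_fin.
      by have := expR_ge1Dx (- t * u ^+ 2); lra.
  rewrite ge0_integralD//; last 3 first.
  - apply/measurable_EFinP; apply: measurableT_comp => //.
    exact: measurable_funM.
  - by move=> u _; rewrite -EFinM lee_fin mulr_ge0 ?sqr_ge0 ?(ltW t0).
  - by apply/measurable_EFinP; exact: measurable_funM.
  rewrite ge0_integralZl//; last 3 first.
  - exact: measurable_EFin_pow.
  - by move=> u _; rewrite lee_fin sqr_ge0.
  - by rewrite lee_fin ltW.
  rewrite leeD2r// integral_normal_expR_sqr; last lra.
  by rewrite lee_fin mulrN opprK invr_sqrt_lo// t0 t4.
have mfin : m \is a fin_num.
  rewrite ge0_fin_numE// ltey; apply/eqP => my.
  have h4 : 0 < (1 / 4 : R) <= 1 / 4 by clear; lra.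
  have := up (1 / 4) h4; rewrite my gt0_muley ?lte_fin; last by clear; lra.
  by rewrite addey.
rewrite -(fineK mfin) in up lo *; move: (fine m) up lo => r up lo.
congr EFin; apply/eqP; rewrite eq_le; apply/andP; split; apply/ler_addgt0Pr => e e0.
- pose t := Num.min (1 / 4) (e / 6).
  have t0 : 0 < t by rewrite lt_min; apply/andP; split; lra.
  have t4 : t <= 1 / 4 by rewrite ge_min lexx.
  have te : t <= e / 6 by rewrite ge_min lexx orbT.
  have := up t; rewrite t0 t4 -EFinM -EFinD lee_fin => /(_ isT); nra.
- pose t := Num.min (1 / 4) (e / 6).
  have t0 : 0 < t by rewrite lt_min; apply/andP; split; lra.
  have t4 : t <= 1 / 4 by rewrite ge_min lexx.
  have te : t <= e / 6 by rewrite ge_min lexx orbT.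
  have := lo t; rewrite t0 t4 -EFinM -EFinD lee_fin => /(_ isT); nra.
Qed.

(** exp x = (exp (x / 8))^8 >= (1 + x / 8)^8, whose quadratic coefficient is
    28 / 64 = 7 / 16. *)
Lemma expR_ge_quad (x : R) : 0 <= x -> 1 + x + 7 / 16 * x ^+ 2 <= expR x.
Proof.
move=> x0; have -> : x = 8%:R * (x / 8) by field.
rewrite expRM_natl; set y := x / 8; have y0 : 0 <= y by rewrite divr_ge0.
apply: (@le_trans _ _ ((1 + y) ^+ 8)); last first.
  by rewrite lerXn2r ?nnegrE ?expR_ge1Dx ?expR_ge0// addr_ge0.
have -> : (1 + y) ^+ 8 = 1 + 8%:R * y + 28%:R * y ^+ 2 + 56%:R * y ^+ 3 +
  70%:R * y ^+ 4 + 56%:R * y ^+ 5 + 28%:R * y ^+ 6 + 8%:R * y ^+ 7 + y ^+ 8 by ring.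
have -> : 7 / 16 * (8%:R * y) ^+ 2 = 28%:R * y ^+ 2 by field.
by rewrite -!addrA !lerD2l lerDl !addr_ge0// ?mulr_ge0// exprn_ge0.
Qed.

(** The exact value is 3; the crude bound suffices for the constants of the
    theorem, and follows from exp(x) >= 1 + x + 7 x^2 / 16 at x = u^2 / 20, whose
    exponential moment is (9 / 10)^(-1/2) <= 58 / 55. *)
Lemma integral_normal_pow4 : (\int[N01]_u (u ^+ 4)%:E <= (9 / 2)%:E)%E.
Proof.
set m := (\int[N01]_u _)%E.
have m0 : (0 <= m)%E.
  by apply: integral_ge0 => u _; rewrite lee_fin exprn_even_ge0.
have c0 : 0 <= 7 / 16 * (1 / 20) ^+ 2 :> R by clear; lra.
have k0 : 0 <= 21 / 20 :> R by clear; lra.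
have h : ((21 / 20 : R)%:E + (7 / 16 * (1 / 20) ^+ 2)%:E * m <= (58 / 55)%:E)%E.
  apply: (@le_trans _ _ (\int[N01]_u (expR (1 / 20 * u ^+ 2))%:E)%E); last first.
    rewrite integral_normal_expR_sqr; last by clear; lra.
    by rewrite lee_fin; apply: invr_sqrt_le; clear; lra.
  have -> : ((21 / 20 : R)%:E + (7 / 16 * (1 / 20) ^+ 2)%:E * m =
      \int[N01]_u (1 + (1 / 20)%:E * (u ^+ 2)%:E + (7 / 16 * (1 / 20) ^+ 2)%:E * (u ^+ 4)%:E))%E.
    have f0 (c : R) n : 0 <= c -> forall u, (setT u -> 0 <= c%:E * (u ^+ n.*2)%:E)%E.
      by move=> cp u _; rewrite -EFinM lee_fin mulr_ge0// exprn_even_ge0// odd_double.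
    have mf (c : R) n : measurable_fun setT (fun u : R => (c%:E * (u ^+ n)%:E)%E).
      by apply/measurable_EFinP; exact: measurable_funM.
    have d0 : 0 <= 1 / 20 :> R by clear; lra.
    rewrite ge0_integralD//; first last.
    - exact: mf.
    - exact: (f0 _ 2).
    - by apply: emeasurable_funD => //; exact: mf.
    - by move=> u _; rewrite adde_ge0// (f0 _ 1).
    rewrite ge0_integralD//; first last.
    - exact: mf.
    - exact: (f0 _ 1).
    rewrite !ge0_integralZl//; first last.
    - by move=> u _; rewrite lee_fin sqr_ge0.
    - exact: measurable_EFin_pow.
    - by move=> u _; rewrite lee_fin exprn_even_ge0.
    - exact: measurable_EFin_pow.
    rewrite integral_normal_cst integral_normal_sqr mule1 -EFinD.
    by congr (_%:E + _)%E; clear; field.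
  apply: ge0_le_integral => //.
  - move=> u _; rewrite -!EFinM -!EFinD lee_fin !addr_ge0// mulr_ge0// ?sqr_ge0//.
    by rewrite exprn_even_ge0.
  - apply/measurable_EFinP; apply: measurable_funD; last exact: measurable_funM.
    by apply: measurable_funD => //; exact: measurable_funM.
  - apply/measurable_EFinP; apply: measurableT_comp => //.
    exact: measurable_funM.
  - move=> u _; rewrite -!EFinM -!EFinD lee_fin.
    have := @expR_ge_quad (1 / 20 * u ^+ 2); rewrite exprMn -exprM.
    have := sqr_ge0 u; lra.
have mfin : m \is a fin_num.
  rewrite ge0_fin_numE// ltey; apply/eqP => my; move: h.
  by rewrite my gt0_muley ?lte_fin; [rewrite addey|clear; lra].
move: h; rewrite -(fineK mfin) -EFinM -EFinD !lee_fin; move: (fine m) => r.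
by clear; lra.
Qed.

Lemma integrable_normal_pow n : (n <= 4)%N ->
  (N01 : {measure set (measurableTypeR R) -> \bar R}).-integrable setT (fun u : R => (u ^+ n)%:E).
Proof.
move=> n4.
apply: (@le_integrable _ (measurableTypeR R) R (N01 : {measure set (measurableTypeR R) -> \bar R}) setT measurableT (fun u : measurableTypeR R => (u ^+ n)%:E)
  (fun u : measurableTypeR R => (1 + (u : R) ^+ 4)%:E)).
- exact: measurable_EFin_pow.
- move=> u _; rewrite !abse_EFin lee_fin; apply: le_trans (ler_norm _).
  rewrite normrX -[X in 1 + X]ger0_norm ?exprn_even_ge0// normrX.
  have [u1|u1] := leP `|u| 1.
    by apply: (@le_trans _ _ 1); [exact: exprn_ile1|rewrite lerDl exprn_ge0].
  by apply: (@le_trans _ _ (`|u| ^+ 4)); rewrite ?ler_weXn2l ?lerDr// ltW.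
- apply/integrableP; split.
    by apply/measurable_EFinP; exact: measurable_funD.
  under eq_integral => u _ do rewrite abse_EFin ger0_norm ?addr_ge0 ?exprn_even_ge0//.
  under eq_integral do rewrite EFinD.
  rewrite ge0_integralD//; last 2 first.
  - by move=> u _; rewrite lee_fin exprn_even_ge0.
  - exact: measurable_EFin_pow.
  rewrite integral_normal_cst lte_add_pinfty ?ltry//.
  by rewrite (le_lt_trans integral_normal_pow4) ?ltry.
Qed.

(** The standard normal law is symmetric, so the integral equals its opposite. *)
Lemma integral_normal_id : (\int[N01]_u u%:E = 0)%E.
Proof.
pose N : {measure set (measurableTypeR R) -> \bar R} := N01.
have int1 : N.-integrable setT (fun u : R => u%:E) := integrable_normal_pow (n := 1) isT.
pose h : measurableTypeR R -> measurableTypeR R := fun u => -1 * u + 0.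
have mh : measurable_fun setT h := measurable_affine (-1) 0.
pose nu : {measure set (measurableTypeR R) -> \bar R} := pushforward N h.
have NE (A : set R) : measurable A -> nu mh A = N A.
  move=> mA; have c0 : -1 != 0 :> R by rewrite oppr_eq0 oner_eq0.
  by have := normal_prob_affine 0 c0 mA; rewrite normrN1; apply.
have E : (\int[N]_u u%:E = \int[N]_u (- u)%:E)%E.
  transitivity (\int[nu mh]_u u%:E)%E.
    by apply: eq_measure_integral => A mA _; rewrite -NE.
  rewrite integral_pushforward//.
  - by apply: eq_integral => u _; rewrite /= /h mulN1r addr0.
  - rewrite preimage_setT; have := integrableN int1.
    by apply: eq_integrable => // u _; rewrite /= /h mulN1r addr0.
have fin : (\int[N]_u u%:E)%E \is a fin_num by exact: integrable_fin_num int1.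
move: E; under [in RHS]eq_integral do rewrite EFinN.
rewrite integralN/=.
- rewrite -(fineK fin) -EFinN => -[]; move: (fine _) => r h0.
  by congr EFin; move: h0; clear; lra.
- exact: (integrable_add_def measurableT int1).
Qed.

Lemma integral_normal_poly (c0 c1 c2 c4 : R) :
  (\int[N01]_u (c0 + c1 * u + c2 * u ^+ 2 + c4 * u ^+ 4)%:E =
   (c0 + c2)%:E + c4%:E * \int[N01]_u (u ^+ 4)%:E)%E.
Proof.
pose N : {measure set (measurableTypeR R) -> \bar R} := N01.
have intc (c : R) n : (n <= 4)%N ->
    N.-integrable setT (fun u : R => (c%:E * (u ^+ n)%:E)%E).
  by move=> n4; apply: integrableZl => //; exact: integrable_normal_pow.
have i0 := intc c0 0 isT; have i1 := intc c1 1 isT.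
have i2 := intc c2 2 isT; have i4 := intc c4 4 isT.
have i01 := integrableD measurableT i0 i1.
have i012 := integrableD measurableT i01 i2.
have Zl (c : R) n : (n <= 4)%N ->
    (\int[N]_u (c%:E * (u ^+ n)%:E) = c%:E * \int[N]_u (u ^+ n)%:E)%E.
  by move=> n4; rewrite integralZl//; exact: integrable_normal_pow.
transitivity (\int[N]_u (c0%:E * (u ^+ 0)%:E + c1%:E * (u ^+ 1)%:E +
    c2%:E * (u ^+ 2)%:E + c4%:E * (u ^+ 4)%:E))%E.
  by apply: eq_integral => u _; rewrite -!EFinM -!EFinD expr0 expr1 mulr1.
rewrite integralD// integralD// integralD// !Zl//.
rewrite integral_normal_cst integral_normal_id integral_normal_sqr.
by rewrite mule0 adde0 !mule1 -EFinD.
Qed.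
End moments.

(** * Convolution of centred normal laws *)

Section convolution.
Variable R : realType.
Notation mu := (@lebesgue_measure R).

(** Both sides are the joint density of (V, V + W) with V of standard deviation
    s and W of standard deviation k: on the right it is factored as the law of
    the sum times the conditional law of V. *)
Lemma normal_pdf_mul (k s v w : R) : 0 < k -> 0 < s ->
  let S := Num.sqrt (k ^+ 2 + s ^+ 2) in
  normal_pdf v k w * normal_pdf 0 s v =
  normal_pdf 0 S w * normal_pdf (w * s ^+ 2 / S ^+ 2) (k * s / S) v.
Proof.
move=> k0 s0 S; have S2 : S ^+ 2 = k ^+ 2 + s ^+ 2.
  by rewrite sqr_sqrtr// addr_ge0 ?sqr_ge0.
have S0 : 0 < S by rewrite sqrtr_gt0 addr_gt0 ?exprn_gt0.
have t0 : 0 < k * s / S by rewrite divr_gt0 ?mulr_gt0.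
rewrite !normal_pdfE ?gt_eqF//= /normal_peak /normal_fun.
rewrite [LHS]mulrACA [RHS]mulrACA -!expRD; congr (_ * expR _).
  rewrite -!invfM; congr (_^-1).
  rewrite -[LHS]sqrtrM ?mulrn_wge0 ?mulr_ge0 ?sqr_ge0 ?pi_ge0 ?invr_ge0 ?ltW//.
  rewrite -[RHS]sqrtrM ?mulrn_wge0 ?mulr_ge0 ?sqr_ge0 ?pi_ge0 ?invr_ge0 ?ltW//.
  congr Num.sqrt.
  by field; exact: lt0r_neq0.
have h : k ^+ 2 + s ^+ 2 != 0 by rewrite gt_eqF// addr_gt0 ?exprn_gt0.
rewrite expr_div_n !S2; field.
by rewrite h !gt_eqF.
Qed.

Lemma measurable_normal_pdf2 (k : R) : 0 < k ->
  measurable_fun setT (fun x : measurableTypeR R * measurableTypeR R => normal_pdf x.1 k x.2).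
Proof.
move=> k0.
have -> : (fun x : measurableTypeR R * measurableTypeR R => normal_pdf x.1 k x.2) =
  (fun x : measurableTypeR R * measurableTypeR R => normal_peak k * expR (- (x.2 - x.1 : R) ^+ 2 / (k ^+ 2 *+ 2))).
  by apply/funext => x; rewrite normal_pdfE// gt_eqF.
apply: measurable_funM => //; apply: measurableT_comp => //.
apply: measurable_funM => //; apply: measurableT_comp => //.
apply: measurable_funX; apply: measurable_funB; [exact: measurable_snd|exact: measurable_fst].
Qed.

(** Fubini and [normal_pdf_mul]: integrating out the conditional density leaves
    the density of the sum. *)
Lemma normal_prob_conv (c s : R) (B : set R) : c != 0 -> 0 < s -> measurable B ->
  (\int[normal_prob 0 s]_v normal_prob 0 1 ((fun u => (c * u + v)%R) @^-1` B) =
   normal_prob 0 (Num.sqrt (c ^+ 2 + s ^+ 2)) B)%E.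
Proof.
move=> c0 s0 mB; have k0 : 0 < `|c| by rewrite normr_gt0.
rewrite -real_normK ?num_real//; set k := `|c| in k0 *.
under eq_integral do rewrite (normal_prob_affine _ c0 mB).
rewrite -/k.
pose G : measurableTypeR R * measurableTypeR R -> \bar R := fun x =>
  ((normal_pdf x.1 k x.2 * \1_B x.2)%:E).
have mG : measurable_fun setT G.
  apply/measurable_EFinP; apply: measurable_funM; first exact: measurable_normal_pdf2.
  by apply: measurableT_comp; [exact: measurable_indic|exact: measurable_snd].
have G0 x : (0 <= G x)%E by rewrite lee_fin mulr_ge0 ?normal_pdf_ge0.
have FE v : normal_prob v k B = (\int[mu]_w G (v, w))%E.
  rewrite /normal_prob integral_mkcond; apply: eq_integral => w _.
  by rewrite /G/= patchE indicE; case: ifP; rewrite ?mulr1 ?mulr0.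
under eq_integral do rewrite FE.
rewrite ge0_integral_normal_prob; last 2 first.
- have hF := measurable_fun_fubini_tonelli_F (m2 := mu) G mG G0.
  exact: hF.
- by move=> v; apply: integral_ge0.
pose H : measurableTypeR R * measurableTypeR R -> \bar R := fun x =>
  (G x * (normal_pdf 0 s x.1)%:E)%E.
have mH : measurable_fun setT H.
  apply: emeasurable_funM => //; apply/measurable_EFinP.
  by apply: measurableT_comp; [exact: measurable_normal_pdf|exact: measurable_fst].
have H0 x : (0 <= H x)%E by rewrite mule_ge0// lee_fin normal_pdf_ge0.
transitivity (\int[mu]_v \int[mu]_w H (v, w))%E.
  apply: eq_integral => v _; rewrite -ge0_integralZr//.
  - exact: measurableT_comp mG (pair1_measurable v).
  - by rewrite lee_fin normal_pdf_ge0.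
rewrite (fubini_tonelli H mH H0) /normal_prob [RHS]integral_mkcond.
apply: eq_integral => w _; rewrite patchE.
set S := Num.sqrt _; rewrite /H /G/=.
have [wB|wB] := boolP (w \in B); last first.
  by apply: integral0_eq => v _; rewrite indicE (negbTE wB) mulr0 mul0e.
under eq_integral do rewrite indicE wB mulr1 -EFinM normal_pdf_mul// EFinM.
rewrite ge0_integralZl//.
- by rewrite integral_normal_pdf mule1.
- exact: measurable_normal_pdfE.
- by move=> v _; rewrite lee_fin normal_pdf_ge0.
- by rewrite lee_fin normal_pdf_ge0.
Qed.
End convolution.

(** * Normal quantiles and the threshold constant *)

Section quantile.
Variable R : realType.
Notation mu := (@lebesgue_measure R).
Notation N01 := (normal_prob (0 : R) 1).

Lemma normal_probU (A B : set R) : measurable A -> measurable B ->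
  A `&` B = set0 -> N01 (A `|` B) = (N01 A + N01 B)%E.
Proof. exact: (@measureU _ _ _ N01). Qed.

Lemma integral_normal_indic (A : set R) : measurable A ->
  (\int[N01]_u (\1_A u)%:E = N01 A)%E.
Proof. by move=> mA; rewrite integral_indic// setIT. Qed.

Lemma normal_prob_fin (A : set R) : measurable A -> N01 A \is a fin_num.
Proof. exact: (@fin_num_measure _ _ _ N01). Qed.

Lemma PhiE (x : R) : (Phi x)%:E = N01 `]-oo, x].
Proof. by rewrite /Phi fineK// normal_prob_fin. Qed.

Lemma normal_prob_set1 (x : R) : N01 [set x] = 0%E.
Proof.
have /null_content_dominatesP := @normal_prob_dominates R 0 1.
by apply => //; exact: lebesgue_measure_set1.
Qed.

Lemma PhiB (x y : R) : x <= y -> (Phi y - Phi x)%:E = N01 `]x, y].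
Proof.
move=> xy; rewrite EFinB !PhiE.
have -> : `]-oo, y]%classic = `]-oo, x] `|` `]x, y].
  by rewrite -itv_bndbnd_setU.
rewrite normal_probU//.
- by rewrite addeAC subee ?add0e// normal_prob_fin.
- rewrite -subset0 => u /=; rewrite !in_itv/= => -[ux /andP[xu _]].
  by move: (le_lt_trans ux xu); rewrite ltxx.
Qed.

Lemma Phi_le (x y : R) : x <= y -> Phi x <= Phi y.
Proof. by move=> xy; rewrite -subr_ge0 -lee_fin PhiB. Qed.

Lemma Phi_tail (x : R) : N01 `]x, +oo[ = (1 - Phi x)%:E.
Proof.
have : (N01 setT = 1)%E := @probability_setT _ _ _ N01.
have -> : [set: R] = `]-oo, x] `|` `]x, +oo[.
  by rewrite -itv_bndbnd_setU// set_itvNyy.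
rewrite normal_probU//; last first.
  rewrite -subset0 => u /=; rewrite !in_itv/= andbT => -[ux xu].
  by move: (le_lt_trans ux xu); rewrite ltxx.
by rewrite -PhiE EFinB => <-; rewrite addeAC subee// add0e.
Qed.

(** Lipschitz continuity of Phi, with the maximum of the density as constant, is
    what allows the intermediate value theorem to produce quantiles. *)
Lemma Phi_lipschitz (x y : R) : x <= y -> Phi y - Phi x <= normal_peak 1 * (y - x).
Proof.
move=> xy; rewrite -lee_fin PhiB// /normal_prob.
apply: (@le_trans _ _ (\int[mu]_(u in `]x, y]) (normal_peak 1)%:E)%E).
  apply: ge0_le_integral => //.
  - by move=> u _; rewrite lee_fin normal_pdf_ge0.
  - by apply: measurable_funTS; exact: measurable_normal_pdfE.
  - by move=> u _; rewrite lee_fin normal_pdf_ub ?oner_eq0.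
rewrite integral_cst//= lebesgue_measure_itv/= lte_fin EFinM EFinB.
by case: ltP => // yx; rewrite (_ : y = x) ?subee ?mule0//; apply/eqP; rewrite eq_le yx xy.
Qed.

Lemma continuous_Phi : continuous (@Phi R).
Proof.
move=> x; apply/cvgrPdist_le => e e0.
have p0 : 0 < normal_peak 1 :> R by rewrite normal_peak_gt0 ?oner_eq0.
near=> y; apply: (@le_trans _ _ (normal_peak 1 * `|x - y|)).
  have [xy|/ltW yx] := leP x y.
    by rewrite distrC (distrC x) !ger0_norm ?subr_ge0 ?Phi_le// Phi_lipschitz.
  by rewrite !ger0_norm ?subr_ge0 ?Phi_le// Phi_lipschitz.
rewrite -ler_pdivlMl// mulrC; near: y.
by apply: cvgr_dist_le; [exact: cvg_id|rewrite divr_gt0].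
Unshelve. all: by end_near. Qed.

Lemma Phi0 : Phi 0 = 1 / 2 :> R.
Proof.
have c0 : -1 != 0 :> R by rewrite oppr_eq0 oner_eq0.
have := normal_prob_affine 0 c0 (measurable_itv `]-oo, (0 : R)]).
rewrite normrN1 -PhiE.
have -> : (fun x : R => -1 * x + 0) @^-1` `]-oo, 0] = [set 0] `|` `]0, +oo[.
  apply/seteqP; split => x /=; rewrite !in_itv/= mulN1r addr0 oppr_le0 andbT.
    by rewrite le_eqVlt => /orP[/eqP|]; [left|right].
  by move=> [->|/ltW].
rewrite normal_probU//; last first.
  by rewrite -subset0 => u /= [->]; rewrite in_itv/= ltxx.
rewrite normal_prob_set1 add0e Phi_tail => -[]; lra.
Qed.

(** The quantile exists by the intermediate value theorem between 0, where
    Phi is 1 / 2, and b = 1 / 2 - log a: integrating 1_(u > b) <= exp(u - b) gives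
    1 - Phi b <= exp(1 / 2 - b) = a. *)
Lemma normal_upperP (a : R) : 0 < a < 1 / 2 ->
  0 < normal_upper a /\ N01 `]normal_upper a, +oo[ = a%:E.
Proof.
move=> /andP[a0 a2].
have ex : exists x, [set x : R | Phi x = 1 - a] x.
  (* The exponential moment of u is exp(1 / 2). *)
  pose b : R := 1 / 2 - ln a.
  have hb : 1 - a <= Phi b.
    rewrite lerBlDl -lerBlDr -lee_fin -Phi_tail.
    apply: (@le_trans _ _ (\int[N01]_u (expR (1 * u + 0 * u ^+ 2 ) * expR (- b))%:E)%E).
      rewrite -integral_normal_indic//.
      apply: ge0_le_integral => //.
      - by apply/measurable_EFinP; exact: measurable_indic.
      - apply/measurable_EFinP; apply: measurable_funM => //; apply: measurableT_comp => //.
        by apply: measurable_funD; exact: measurable_funM.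
      - move=> u _; rewrite lee_fin indicE mul1r mul0r addr0 -expRD.
        case: (boolP (u \in _)); rewrite ?expR_ge0// inE/= in_itv/= andbT => bu.
        by rewrite -expR0 ler_expR subr_ge0 ltW.
    under eq_integral do rewrite EFinM.
    rewrite ge0_integralZr ?lee_fin ?expR_ge0//; last first.
      apply/measurable_EFinP; apply: measurableT_comp => //.
      by apply: measurable_funD; exact: measurable_funM.
    rewrite integral_normal_expR_quad; last by clear; lra.
    rewrite mulr0 subr0 sqrtr1 invr1 mul1r expr1n mulr1 -EFinM lee_fin -expRD.
    by rewrite /b opprB addrCA subrr addr0 lnK.
  have b0 : 0 <= b.
    rewrite leNgt; apply/negP => /ltW/Phi_le; rewrite Phi0.
    by move: hb a2; clear; lra.
  have [||x _ xE] := @IVT R (@Phi R) 0 b (1 - a) b0.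
  - by apply: continuous_subspaceT; exact: continuous_Phi.
  - rewrite Phi0 ge_min le_max hb orbT andbT; apply/orP; left.
    by move: a2; clear; lra.
  by exists x.
have /= E : [set x : R | Phi x = 1 - a] (normal_upper a) := xgetPex 0 ex.
split; last by rewrite Phi_tail E; congr EFin; clear; lra.
rewrite ltNge; apply/negP => /Phi_le; rewrite Phi0 E; move: a2; clear; lra.
Qed.

Lemma normal_prob_upper_tail (a s : R) : 0 < a < 1 / 2 -> 0 < s ->
  normal_prob 0 s `]s * normal_upper a, +oo[ = a%:E.
Proof.
move=> /normal_upperP[_ <-] s0.
set I := `]s * normal_upper a, +oo[%classic.
have h := normal_prob_affine 0 (lt0r_neq0 s0) (measurable_itv _ : measurable I).
have sE : `|s| = s by rewrite gtr0_norm.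
rewrite sE in h; apply: etrans (esym h) _.
suff -> : (fun u => s * u + 0) @^-1` I = `]normal_upper a, +oo[%classic by [].
by apply/seteqP; split => x /=; rewrite /I/= !in_itv/= !andbT addr0 ltr_pM2l.
Qed.

(** x - log x is 1 at x = 1 and at least 5 at x = exp 3, as exp 3 >= 8. *)
Lemma lambda_starP : 1 < lambda_star R /\ lambda_star R - ln (lambda_star R) = 5.
Proof.
suff ex : exists x, [set x : R | 1 < x /\ x - ln x = 5] x.
  exact: (xgetPex 0 ex).
have e8 : 8 <= expR 3 :> R.
  rewrite -[3]mulr1 expRM_natl; apply: (@le_trans _ _ ((1 + 1) ^+ 3)).
    by clear; lra.
  by rewrite lerXn2r ?nnegrE ?expR_ge0// expR_ge1Dx.
have e1 : 1 <= expR 3 :> R by move: e8; clear; lra.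
have [||x] := @IVT R (fun x => x - ln x) 1 (expR 3) 5 e1.
- apply: continuous_in_subspaceT => x; rewrite inE/= in_itv/= => /andP[x1 _].
  apply: continuousB; first exact: cvg_id.
  by apply: continuous_ln; exact: lt_le_trans x1.
- rewrite expRK ln1 subr0 ge_min le_max; apply/andP; split; apply/orP; [left|right].
    by clear; lra.
  by move: e8; clear; lra.
rewrite in_itv/= => /andP[x1 _] xE; exists x; split => //.
rewrite lt_neqAle x1 andbT; apply/eqP => x1E.
by move: xE; rewrite -x1E ln1 subr0; clear; lra.
Qed.
End quantile.

(** * Sums of functions of independent variables *)

Lemma measurable_set_le d (T : measurableType d) (R : realType) (f g : T -> R) :
  measurable_fun setT f -> measurable_fun setT g ->
  measurable [set w | f w <= g w].
Proof.
by move=> mf mg; rewrite -[X in measurable X]setTI; exact: measurable_fun_le.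
Qed.

Lemma measurable_set_lt d (T : measurableType d) (R : realType) (f g : T -> R) :
  measurable_fun setT f -> measurable_fun setT g ->
  measurable [set w | f w < g w].
Proof.
move=> mf mg; rewrite (_ : [set w | _] = ~` [set w | g w <= f w]).
  by apply: measurableC; exact: measurable_set_le.
by apply/seteqP; split => w /=; rewrite ltNge => /negP.
Qed.

Lemma eq_indic (R : nzRingType) (T U : Type) (A : set T) (B : set U) a b :
  (A a <-> B b) -> \1_A a = \1_B b :> R.
Proof.
move=> AB; rewrite !indicE; congr (nat_of_bool _)%:R.
by apply/idP/idP; rewrite !inE => /AB.
Qed.

Lemma integral_prob_cst d (T : measurableType d) (R : realType)
  (P : probability T R) (c : R) : (\int[P]_w c%:E = c%:E)%E.
Proof. by have := expectation_cst P c; rewrite unlock. Qed.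

Lemma integral_prob_indic d (T : measurableType d) (R : realType)
  (P : probability T R) (A : set T) : measurable A ->
  (\int[P]_w (\1_A w)%:E = P A)%E.
Proof. by move=> mA; rewrite integral_indic// setIT. Qed.

(** The real line carries two measurable structures, equal as sigma-algebras but
    indexed by different displays; the identity map transports integrals from
    one to the other. *)
Lemma eq_measureR_integral (R : realType) (nu : {measure set R -> \bar R})
    (N : {measure set (measurableTypeR R) -> \bar R}) (f : R -> \bar R) :
  (forall A : set R, measurable A -> nu A = N A) ->
  measurable_fun setT f -> (forall u, 0 <= f u)%E ->
  (\int[nu]_u f u = \int[N]_u f u)%E.
Proof.
move=> nuN mf f0; pose idR : measurableTypeR R -> R := idfun.
have mid : measurable_fun setT idR by exact: measurable_id.
pose nu' : {measure set R -> \bar R} := pushforward N idR.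
transitivity (\int[nu' mid]_u f u)%E.
  by apply: eq_measure_integral => A mA _; exact: nuN.
by rewrite ge0_integral_pushforward.
Qed.

Section independent_sums.
Context disp (T : measurableType disp) (R : realType) (P : probability T R).
Context (I : finType) (z : I -> {RV P >-> R}) (g : I -> R -> R).
Hypothesis indep : mutually_independent z.
Hypothesis mg : forall i, measurable_fun setT (g i).

Definition psum (s : seq I) (w : T) : R := \sum_(i <- s) g i (z i w).

Lemma measurable_psum s : measurable_fun setT (psum s).
Proof. by apply: measurable_sum => i; exact: measurableT_comp. Qed.

Definition psumRV s : {RV P >-> R} :=
  HB.pack (psum s) (isMeasurableFun.Build _ _ _ _ _ (measurable_psum s)).

Definition cyl (C : I -> set R) : set T := \bigcap_(i in [set: I]) (z i @^-1` C i).

Lemma measurable_cyl C : (forall i, measurable (C i)) -> measurable (cyl C).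
Proof.
move=> mC; apply: fin_bigcap_measurable; first exact: finite_finset.
by move=> i _; rewrite -[X in measurable X]setTI; exact: measurable_funP.
Qed.

Lemma prob_cylU1 x (A : set R) C : measurable A -> (forall i, measurable (C i)) ->
  C x = setT ->
  P (cyl (fun i => if i == x then A else C i)) = (P (z x @^-1` A) * P (cyl C))%E.
Proof.
move=> mA mC Cx; rewrite !indep//; last by move=> i; case: ifP.
rewrite (bigD1 x)//= eqxx [in RHS](bigD1 x)//= Cx preimage_setT probability_setT mul1e.
by congr (_ * _)%E; apply: eq_bigr => i /negbTE ->.
Qed.

Definition pairRV x s (w : T) : R * R := (z x w, psum s w).

Lemma measurable_pairRV x s : measurable_fun setT (pairRV x s).
Proof. by apply: measurable_fun_pair => //; exact: measurable_psum. Qed.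

(** Both sides are measures in D, up to the factor P (cyl C) which is divided out;
    they agree on rectangles by the independence of the sum over s (the
    hypothesis) and of z x, and rectangles determine product measures. The
    cylinder C, unconstrained at the indices already used, carries the remaining
    variables along so that the induction of [indep_psum_cyl] closes. *)
Lemma indep_pairP x s C (D : set (R * R)) :
  (forall B, measurable B -> forall C', (forall i, measurable (C' i)) ->
     {in s, forall i, C' i = setT} ->
     P (psum s @^-1` B `&` cyl C') = (P (psum s @^-1` B) * P (cyl C'))%E) ->
  x \notin s -> (forall i, measurable (C i)) -> {in x :: s, forall i, C i = setT} ->
  measurable D ->
  P (pairRV x s @^-1` D `&` cyl C) =
  (P (cyl C) * (distribution P (z x) \x distribution P (psumRV s)) D)%E.
Proof.
move=> IH xs mC CT mD; have mE := measurable_cyl mC.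
have mpair : measurable (pairRV x s @^-1` D).
  by rewrite -[X in measurable X]setTI; exact: measurable_pairRV.
have [P0|P0] := eqVneq (P (cyl C)) 0%E.
  rewrite P0 mul0e; apply/eqP; rewrite eq_le measure_ge0 andbT -P0 le_measure ?inE//.
  by apply: measurableI.
have Pfin : P (cyl C) \is a fin_num by exact: fin_num_measure.
pose p := fine (P (cyl C)).
have PE : P (cyl C) = p%:E by rewrite fineK.
have p0 : 0 < p by rewrite -lte_fin -PE lt0e P0 measure_ge0.
pose c : {nonneg R} := NngNum (ltW (divr_gt0 ltr01 p0)).
pose nu := mscale c (pushforward (mrestr P mE) (pairRV x s)).
rewrite (@product_measure_unique _ _ _ _ _ (distribution P (z x))
  (distribution P (psumRV s)) (nu (measurable_pairRV x s)))//.
  rewrite /nu/= /mscale/= /pushforward /mrestr PE muleA -EFinM.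
  by rewrite mul1r divff ?gt_eqF// mul1e.
move=> A B mA mB; rewrite /nu/= /mscale/= /pushforward /mrestr.
have -> : pairRV x s @^-1` (A `*` B) `&` cyl C =
   psum s @^-1` B `&` cyl (fun i => if i == x then A else C i).
  apply/seteqP; split=> w /=.
    move=> [[wA wB] wC]; split => // i _ /=; have [->//|ix] := eqVneq i x.
    exact: wC.
  move=> [wB wC]; split; first split => //.
    by have /= := wC x Logic.I; rewrite eqxx.
  move=> i _ /=; have [->|ix] := eqVneq i x; first by rewrite CT ?mem_head.
  by have /= := wC i Logic.I; rewrite (negbTE ix).
rewrite IH//; first last.
- move=> i si; case: eqVneq => [ix|_]; first by rewrite -ix si in xs.
  by rewrite CT// inE si orbT.
- by move=> i; case: ifP.
rewrite prob_cylU1// ?CT ?mem_head// PE /= (muleC _ p%:E) (muleCA _ p%:E).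
by rewrite (muleA (1 / p)%:E) -EFinM mul1r mulVf ?gt_eqF// mul1e muleC.
Qed.

Lemma indep_psum_cyl s : uniq s -> forall B, measurable B ->
  forall C, (forall i, measurable (C i)) -> {in s, forall i, C i = setT} ->
  P (psum s @^-1` B `&` cyl C) = (P (psum s @^-1` B) * P (cyl C))%E.
Proof.
elim: s => [_ B mB C mC _|x s IH /= /andP[xs us] B mB C mC CT].
  have [B0|B0] := pselect (B 0).
    have -> : psum [::] @^-1` B = setT.
      by apply/seteqP; split => // w _; rewrite /= /psum big_nil.
    by rewrite setTI probability_setT mul1e.
  have -> : psum [::] @^-1` B = set0.
    by apply/seteqP; split => // w; rewrite /= /psum big_nil.
  by rewrite set0I !measure0 mul0e.
pose D : set (R * R) := (fun uv => g x uv.1 + uv.2) @^-1` B.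
have mD : measurable D.
  have mf : measurable_fun setT (fun uv : R * R => g x uv.1 + uv.2).
    by apply: measurable_funD => //; exact: measurableT_comp.
  by rewrite -[X in measurable X]setTI; exact: mf.
have DE : psum (x :: s) @^-1` B = pairRV x s @^-1` D.
  by apply/seteqP; split => w; rewrite /D /= /psum big_cons.
have cT : cyl (fun=> setT) = setT by apply/seteqP; split.
have := @indep_pairP x s (fun=> setT) D (IH us) xs (fun=> measurableT) (fun _ _ => erefl) mD.
rewrite cT setIT probability_setT mul1e DE => ->.
by rewrite (indep_pairP (IH us)) 1?muleC.
Qed.

(** Integrating out z x first, with the sum over s as a parameter. *)
Lemma ge0_integral_indep x s (h : R * R -> \bar R) : uniq (x :: s) ->
  measurable_fun setT h -> (forall uv, 0 <= h uv)%E ->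
  (\int[P]_w h (z x w, psum s w) =
   \int[P]_w \int[distribution P (z x)]_u h (u, psum s w))%E.
Proof.
move=> /= /andP[xs us] mh h0.
have mpair := measurable_pairRV x s.
pose nu : {measure set (R * R) -> \bar R} := pushforward P (pairRV x s).
transitivity (\int[nu mpair]_uv h uv)%E.
  by rewrite ge0_integral_pushforward.
transitivity (\int[(distribution P (z x) \x distribution P (psumRV s))%E]_uv h uv)%E.
  apply: eq_measure_integral => D mD _; rewrite /= /pushforward.
  have := @indep_pairP x s (fun=> setT) D (indep_psum_cyl us) xs (fun=> measurableT) (fun _ _ => erefl) mD.
  have -> : cyl (fun=> setT) = setT by apply/seteqP; split.
  by rewrite setIT probability_setT mul1e.
rewrite (fubini_tonelli2 (m1 := distribution P (z x)) (m2 := distribution P (psumRV s)))//.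
rewrite ge0_integral_distribution//.
- exact: measurable_fun_fubini_tonelli_G.
- by move=> v; exact: integral_ge0.
Qed.
End independent_sums.

(** * Sums over i.i.d. standard normal variables *)

Section gaussian_sums.
Context disp (T : measurableType disp) (R : realType) (P : probability T R).
Context (I : finType) (z : I -> {RV P >-> R}).
Hypothesis iid : iid_std_normal z.
Notation N01 := (normal_prob (0 : R) 1).

Lemma ge0_integral_distribution_iid x (f : R -> \bar R) :
  measurable_fun setT f -> (forall u, 0 <= f u)%E ->
  (\int[distribution P (z x)]_u f u = \int[N01]_u f u)%E.
Proof.
by apply: eq_measureR_integral => A mA; exact: iid.1.
Qed.

Lemma ge0_integral_iid (g : I -> R -> R) x s (h : R * R -> \bar R) :
  (forall i, measurable_fun setT (g i)) -> uniq (x :: s) ->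
  measurable_fun setT h -> (forall uv, 0 <= h uv)%E ->
  (\int[P]_w h (z x w, psum z g s w) =
   \int[P]_w \int[N01]_u h (u, psum z g s w))%E.
Proof.
move=> mg us mh h0; rewrite (ge0_integral_indep iid.2 mg us mh h0).
apply: eq_integral => w _; rewrite ge0_integral_distribution_iid//.
exact: measurableT_comp mh (pair2_measurable _).
Qed.

Lemma integral_expR_psum (a b : I -> R) s : uniq s -> (forall i, b i < 1 / 2) ->
  (\int[P]_w (expR (psum z (fun i u => a i * u + b i * u ^+ 2)%R s w))%:E =
   (\prod_(i <- s) ((Num.sqrt (1 - 2 * b i))^-1 *
                    expR (a i ^+ 2 / (2 * (1 - 2 * b i)))))%:E)%E.
Proof.
move=> + b2; set g := (fun (i : I) (u : R) => a i * u + b i * u ^+ 2).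
have mg i : measurable_fun setT (g i).
  by apply: measurable_funD; exact: measurable_funM.
elim: s => [_|x s IH us].
  rewrite big_nil; under eq_integral do rewrite /psum big_nil expR0.
  by rewrite integral_prob_cst.
(* The sum over x :: s as a function of the pair (z x, sum over s). *)
pose h (uv : R * R) := (expR (g x uv.1 + uv.2))%:E.
transitivity (\int[P]_w h (z x w, psum z g s w))%E.
  by apply: eq_integral => w _; rewrite /h /psum big_cons.
rewrite (ge0_integral_iid mg us).
- rewrite big_cons EFinM -IH; last by case/andP: us.
  rewrite -integral_normal_expR_quad// -ge0_integralZl//=.
  + apply: eq_integral => w _; rewrite /h/= -ge0_integralZr ?lee_fin ?expR_ge0//.
      by apply: eq_integral => u _; rewrite expRD EFinM.
    by apply/measurable_EFinP; apply: measurableT_comp => //; exact: (mg x).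
  + apply/measurable_EFinP; apply: measurableT_comp => //.
    exact: measurable_psum.
  + by apply: integral_ge0 => u _; rewrite lee_fin expR_ge0.
- apply/measurable_EFinP; apply: measurableT_comp => //.
  by apply: measurable_funD => //; exact: measurableT_comp.
- by move=> uv; rewrite lee_fin expR_ge0.
Qed.

(** Adding one variable at a time; hypothesis gV is a second moment bound with
    an arbitrary shift v, the shift being the sum of the variables not yet
    integrated. *)
Lemma integral_psum_sqr_le (g : I -> R -> R) (V : I -> R) s (a : R) : uniq s ->
  (forall i, measurable_fun setT (g i)) -> (forall i, 0 <= V i) ->
  (forall i v, \int[N01]_u ((g i u + v) ^+ 2)%:E <= (v ^+ 2 + V i)%:E)%E ->
  (\int[P]_w ((psum z g s w + a) ^+ 2)%:E <= (a ^+ 2 + \sum_(i <- s) V i)%:E)%E.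
Proof.
move=> + mg V0 gV; elim: s => [_|x s IH us].
  rewrite big_nil addr0; under eq_integral do rewrite /psum big_nil add0r.
  by rewrite integral_prob_cst.
pose h (uv : R * R) := ((g x uv.1 + (uv.2 + a)) ^+ 2)%:E.
have h0 uv : (0 <= h uv)%E by rewrite lee_fin sqr_ge0.
have mpa : measurable_fun setT (fun w => (psum z g s w + a) ^+ 2).
  by apply: measurable_funX; apply: measurable_funD => //; exact: measurable_psum.
have mh : measurable_fun setT h.
  apply/measurable_EFinP; apply: measurable_funX.
  apply: measurable_funD; first exact: measurableT_comp.
  by apply: measurable_funD.
have -> : (\int[P]_w ((psum z g (x :: s) w + a) ^+ 2)%:E =
          \int[P]_w h (z x w, psum z g s w))%E.
  by apply: eq_integral => w _; rewrite /h /psum big_cons addrA.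
rewrite (ge0_integral_iid mg us)//.
apply: (@le_trans _ _ (\int[P]_w (((psum z g s w + a) ^+ 2)%:E + (V x)%:E))%E).
  apply: ge0_le_integral => //.
  - by move=> w _; apply: integral_ge0.
  - have mF := measurable_fun_fubini_tonelli_G (m1 := distribution P (z x)) h mh h0.
    have -> : (fun w => \int[N01]_u h (u, psum z g s w))%E =
        (fun w => \int[distribution P (z x)]_u h (u, psum z g s w))%E.
      apply/funext => w; rewrite ge0_integral_distribution_iid//.
      exact: measurableT_comp mh (pair2_measurable _).
    by apply: (measurableT_comp mF); exact: measurable_psum.
  - by apply: emeasurable_funD => //; exact/measurable_EFinP.
  - by move=> w _; rewrite -EFinD; exact: (gV x (psum z g s w + a)).
rewrite ge0_integralD//; last 3 first.
- by move=> w _; rewrite lee_fin sqr_ge0.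
- exact/measurable_EFinP.
- by move=> w _; rewrite lee_fin.
rewrite integral_prob_cst big_cons [V x + _]addrC addrA EFinD.
by rewrite leeD2r//; apply: IH; case/andP: us.
Qed.

(** Given the other summands, g x (z x) would have to hit a single value. *)
Lemma prob_psum_eq0 (g : I -> R -> R) x s (c : R) : uniq (x :: s) ->
  (forall i, measurable_fun setT (g i)) ->
  (forall v, N01 [set u | g x u = v] = 0%E) ->
  P [set w | psum z g (x :: s) w = c] = 0%E.
Proof.
move=> us mg gx.
pose D : set (R * R) := (fun uv => g x uv.1 + uv.2) @^-1` [set c].
have mD : measurable D.
  have mf : measurable_fun setT (fun uv : R * R => g x uv.1 + uv.2).
    by apply: measurable_funD => //; exact: measurableT_comp.
  by rewrite -[X in measurable X]setTI; exact: mf.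
pose h (uv : R * R) : \bar R := (\1_D uv)%:E.
have mA : measurable [set w | psum z g (x :: s) w = c].
  have mf := measurable_psum z mg (x :: s).
  by rewrite -[X in measurable X]setTI; exact: (mf measurableT [set c]).
have -> : P [set w | psum z g (x :: s) w = c] = (\int[P]_w h (z x w, psum z g s w))%E.
  rewrite -integral_prob_indic//.
  apply: eq_integral => w _; congr EFin.
  by apply: eq_indic; rewrite /D /= /psum big_cons.
rewrite (ge0_integral_iid mg us); last 2 first.
- by apply/measurable_EFinP; exact: measurable_indic.
- by move=> uv; rewrite lee_fin.
apply: integral0_eq => w _; rewrite -[RHS](gx (c - psum z g s w)).
rewrite -integral_normal_indic.
  apply: eq_integral => u _; congr EFin.
  by apply: eq_indic; rewrite /D/=; split => [<-|->]; rewrite ?addrK ?subrK.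
have := mg x measurableT [set c - psum z g s w] (measurable_set1 _).
by rewrite setTI.
Qed.

(** Induction with [normal_prob_conv]. A convolution factor of variance 0 is not a
    density, so the cases where the new coefficient or the previous sum
    vanishes are treated apart. *)
Lemma psum_normal (c : I -> R) s (B : set R) : uniq s -> measurable B ->
  0 < \sum_(i <- s) c i ^+ 2 ->
  P (psum z (fun i u => c i * u) s @^-1` B) =
  normal_prob 0 (Num.sqrt (\sum_(i <- s) c i ^+ 2)) B.
Proof.
set g := (fun (i : I) (u : R) => c i * u).
have mg i : measurable_fun setT (g i) by exact: measurable_funM.
elim: s B => [B _ _|x s IH B us mB]; first by rewrite big_nil ltxx.
have s0 : 0 <= \sum_(i <- s) c i ^+ 2 by apply: sumr_ge0 => i _; exact: sqr_ge0.
rewrite big_cons; have [c0|c0] := eqVneq (c x) 0.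
  rewrite c0 expr0n add0r => cs; rewrite -IH//; last by case/andP: us.
  congr (P _); apply/seteqP; split => w; rewrite /= /psum big_cons /g c0 mul0r add0r//.
move: s0; rewrite le_eqVlt => /predU1P[s0 _|s0 _].
  have psum0 w : psum z g s w = 0.
    move: s0 => /esym/eqP; rewrite psumr_eq0 => [/allP s0|i _]; last exact: sqr_ge0.
    rewrite /psum big_seq big1// => i /s0/=.
    by rewrite sqrf_eq0 /g => /eqP ->; rewrite mul0r.
  rewrite -s0 addr0 sqrtr_sqr -(normal_prob_affine 0 c0 mB) -((proj1 iid) x); last first.
    by rewrite -[X in measurable X]setTI; exact: measurable_affine.
  congr (P _); apply/seteqP; split => w; rewrite /= /psum big_cons -/(psum z g s w) psum0//.
rewrite -[X in _ + X]sqr_sqrtr ?(ltW s0)// -(normal_prob_conv c0 _ mB) ?sqrtr_gt0//.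
pose D : set (R * R) := (fun uv => c x * uv.1 + uv.2) @^-1` B.
have mD : measurable D.
  have mf : measurable_fun setT (fun uv : R * R => c x * uv.1 + uv.2).
    apply: measurable_funD => //; apply: measurable_funM => //.
  by rewrite -[X in measurable X]setTI; exact: mf.
pose h (uv : R * R) : \bar R := (\1_D uv)%:E.
have mh : measurable_fun setT h by apply/measurable_EFinP; exact: measurable_indic.
have h0 uv : (0 <= h uv)%E by rewrite lee_fin.
pose f v := (\int[N01]_u h (u, v))%E.
have f0 v : (0 <= f v)%E by exact: integral_ge0.
have mf : measurable_fun setT f.
  have -> : f = (fun v => \int[distribution P (z x)]_u h (u, v))%E.
    apply/funext => v; rewrite ge0_integral_distribution_iid//.
    exact: measurableT_comp mh (pair2_measurable _).
  exact: (measurable_fun_fubini_tonelli_G (m1 := distribution P (z x)) h mh h0).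
have mps : measurable (psum z g (x :: s) @^-1` B).
  have mps := measurable_psum z mg (x :: s).
  by rewrite -[X in measurable X]setTI; exact: mps.
transitivity (\int[P]_w f (psum z g s w))%E.
  rewrite -(ge0_integral_iid mg us mh h0) -(integral_prob_indic P mps).
  apply: eq_integral => w _; congr EFin.
  by apply: eq_indic; rewrite /D /= /psum big_cons.
transitivity (\int[normal_prob 0 (Num.sqrt (\sum_(i <- s) c i ^+ 2))]_v f v)%E.
  transitivity (\int[distribution P (psumRV z mg s)]_v f v)%E.
    by rewrite ge0_integral_distribution.
  apply: eq_measureR_integral => // A mA; apply: IH => //; by case/andP: us.
apply: eq_integral => v _; rewrite /f -integral_normal_indic; last first.
  by rewrite -[X in measurable X]setTI; exact: measurable_affine.
apply: eq_integral => u _; by congr EFin; exact: eq_indic.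
Qed.
End gaussian_sums.

(** * Tail bounds *)

Section tails.
Context disp (T : measurableType disp) (R : realType) (P : probability T R).
Context (I : finType) (z : I -> {RV P >-> R}).
Hypothesis iid : iid_std_normal z.
Notation N01 := (normal_prob (0 : R) 1).

Lemma measurable_sumz (Q : pred I) (g : I -> R -> R) :
  (forall i, measurable_fun setT (g i)) ->
  measurable_fun setT (fun w => \sum_(i | Q i) g i (z i w)).
Proof.
move=> mg; under eq_fun do rewrite big_mkcond.
apply: measurable_sum => i; case: (Q i) => //.
exact: measurableT_comp.
Qed.

Lemma psum_enum (g : I -> R -> R) (Q : pred I) w :
  psum z g (enum Q) w = \sum_(i | Q i) g i (z i w).
Proof. by rewrite /psum big_enum. Qed.

(** Chernoff's bound. *)
Lemma prob_ge_le_expR (X : T -> R) (t : R) (m : \bar R) : measurable_fun setT X ->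
  (\int[P]_w (expR (X w))%:E <= m)%E ->
  (P [set w | t <= X w]%R <= (expR (- t))%:E * m)%E.
Proof.
move=> mX Xm; have mA : measurable [set w | t <= X w].
  exact: measurable_set_le.
have mE : measurable_fun setT (fun w => (expR (X w))%:E).
  by apply/measurable_EFinP; exact: measurableT_comp.
apply: (@le_trans _ _ (\int[P]_w ((expR (- t))%:E * (expR (X w))%:E))%E).
  rewrite -integral_prob_indic//; apply: ge0_le_integral => //.
  - by apply/measurable_EFinP; exact: measurable_indic.
  - exact: measurable_funeM.
  - move=> w _; rewrite -EFinM -expRD lee_fin indicE.
    case: (boolP (w \in _)); rewrite ?expR_ge0// inE/= => tX.
    by rewrite -expR0 ler_expR addrC subr_ge0.
by rewrite ge0_integralZl// lee_pmul2l// lte_fin expR_gt0.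
Qed.

Lemma integral_expR_sumz (a b : I -> R) (Q : pred I) : (forall i, b i < 1 / 2) ->
  (\int[P]_w (expR (\sum_(i | Q i) (a i * z i w + b i * z i w ^+ 2)))%:E =
   (\prod_(i | Q i) ((Num.sqrt (1 - 2 * b i))^-1 *
                     expR (a i ^+ 2 / (2 * (1 - 2 * b i)))))%:E)%E.
Proof.
move=> b2; have := integral_expR_psum iid a (enum_uniq Q) b2.
rewrite big_enum => <-; apply: eq_integral => w _.
by rewrite psum_enum.
Qed.

(** Chernoff's bound at the exponent t = (1 - 1 / lam) / 2, optimal when v = 0;
    there the exponent is - L (lam - 1 - log lam) / 2 = - 2 L by the equation
    that defines lam. *)
Lemma noncentral_chi2_tail (lam : R) (v : I -> R) (Q : pred I) :
  1 < lam -> lam - ln lam = 5 ->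
  (P [set w | lam * #|Q|%:R <= \sum_(i | Q i) (v i + z i w) ^+ 2]%R <=
   (expR (- 2 * #|Q|%:R + (lam - 1) / 2 * \sum_(i | Q i) v i ^+ 2))%:E)%E.
Proof.
move=> l1 lE; set L := #|Q|%:R; set V := \sum_(i | Q i) v i ^+ 2.
have l0 : 0 < lam by exact: lt_trans l1.
pose t := (1 - lam^-1) / 2.
have t0 : 0 < t by rewrite divr_gt0// subr_gt0 invf_lt1.
have t2 : t < 1 / 2 by rewrite /t ltr_pM2r// ltrBlDr ltrDl invr_gt0.
have tE : 1 - 2 * t = lam^-1 by rewrite /t; field; rewrite gt_eqF.
pose X w := \sum_(i | Q i) (2 * t * v i * z i w + t * z i w ^+ 2).
have mX : measurable_fun setT X.
  by apply: (@measurable_sumz Q (fun i u => 2 * t * v i * u + t * u ^+ 2)) => i;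
     apply: measurable_funD; exact: measurable_funM.
have XE w : t * \sum_(i | Q i) (v i + z i w) ^+ 2 = t * V + X w.
  by rewrite !mulr_sumr -big_split/=; apply: eq_bigr => i _; ring.
have -> : [set w | lam * L <= \sum_(i | Q i) (v i + z i w) ^+ 2] =
    [set w | t * lam * L - t * V <= X w].
  by apply/seteqP; split => w /=; rewrite lerBlDl -mulrA -XE ler_pM2l.
apply: (le_trans (prob_ge_le_expR _ mX (lexx _))).
rewrite (integral_expR_sumz (fun i => 2 * t * v i) Q (fun=> t2)).
rewrite -EFinM lee_fin; under eq_bigr do rewrite tE.
rewrite big_split/= prodr_const -expR_sum -/L.
have -> : (Num.sqrt lam^-1)^-1 ^+ #|Q| = expR (ln lam / 2 * L).
  rewrite mulrC expRM_natl; congr (_ ^+ _).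
  rewrite sqrtrV ?ltW// invrK -[X in Num.sqrt X]lnK ?posrE//.
  by rewrite -powR12_sqrt ?expR_ge0// -expRM.
rewrite -!expRD ler_expR.
have -> : \sum_(i | Q i) (2 * t * v i) ^+ 2 / (2 * lam^-1) = 2 * t ^+ 2 * lam * V.
  rewrite mulr_sumr; apply: eq_bigr => i _; field.
  by rewrite gt_eqF.
apply: le_of_eq; have -> : ln lam = lam - 5 by rewrite -lE; ring.
by rewrite /t; field; rewrite gt_eqF.
Qed.

(** Chernoff's bound at the exponent t / V. *)
Lemma gaussian_sum_tail (c : I -> R) (Q : pred I) (V t : R) :
  0 < V -> 0 <= t -> \sum_(i | Q i) c i ^+ 2 <= V ->
  (P [set w | t <= \sum_(i | Q i) c i * z i w]%R <=
   (expR (- (t ^+ 2 / (2 * V))))%:E)%E.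
Proof.
move=> V0 t0 cV; pose l := t / V; have l0 : 0 <= l by rewrite divr_ge0// ltW.
pose X w := \sum_(i | Q i) (l * c i * z i w + 0 * z i w ^+ 2).
have mX : measurable_fun setT X.
  by apply: (@measurable_sumz Q (fun i u => l * c i * u + 0 * u ^+ 2)) => i;
     apply: measurable_funD; exact: measurable_funM.
have XE w : l * \sum_(i | Q i) c i * z i w = X w.
  by rewrite mulr_sumr; apply: eq_bigr => i _; ring.
apply: (@le_trans _ _ (P [set w | l * t <= X w]%R)).
  rewrite le_measure ?inE//.
  - apply: measurable_set_le => //.
    by apply: (@measurable_sumz Q (fun i u => c i * u)) => i; exact: measurable_funM.
  - exact: measurable_set_le.
  - by move=> w /= h; rewrite -XE ler_wpM2l.
apply: (le_trans (prob_ge_le_expR _ mX (lexx _))).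
have b2 : 0 < 1 / 2 :> R by rewrite divr_gt0.
rewrite (integral_expR_sumz (fun i => l * c i) Q (fun=> b2)).
rewrite -EFinM lee_fin mulr0 subr0 sqrtr1 invr1.
under eq_bigr do rewrite mul1r mulr1.
rewrite -expR_sum -expRD ler_expR -mulr_suml.
under eq_bigr do rewrite exprMn.
rewrite -mulr_sumr; apply: (@le_trans _ _ (- (l * t) + l ^+ 2 * V / 2)).
  by rewrite lerD2l ler_pM2r ?invr_gt0// ler_wpM2l ?sqr_ge0.
by apply: le_of_eq; rewrite /l; field; rewrite gt_eqF.
Qed.

(** By the mean value theorem applied to log x - 2 x + x^2 / 2, whose derivative
    (x - 1)^2 / x is nonnegative. *)
Lemma ln1D_ge (u : R) : 0 <= u -> u - u ^+ 2 / 2 <= ln (1 + u).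
Proof.
rewrite le_eqVlt => /predU1P[<-|u0]; first by rewrite expr0n mul0r subr0 addr0 ln1.
pose f (x : R) : R := ln x - 2 * x + 2^-1 * x ^+ 2.
pose df (x : R) : R := x^-1 - 2 + x.
have df' (x : R) : 0 < x -> is_derive x (1 : R) f (df x).
  move=> x0; have h1 := is_derive1_ln x0.
  apply: is_derive_eq; rewrite /df /GRing.scale/=; field.
  by rewrite gt_eqF.
have cf : {within `[1, 1 + u], continuous f}.
  apply: continuous_in_subspaceT => x; rewrite inE/= in_itv/= => /andP[x1 _].
  have x0 : 0 < x by exact: lt_le_trans x1.
  apply: differentiable_continuous; apply/derivable1_diffP.
  by have [] := df' x x0.
have u1 : 1 < 1 + u by rewrite ltrDl.
have dfu (x : R) : x \in `]1, 1 + u[%R -> is_derive x (1 : R) f (df x).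
  rewrite in_itv/= => /andP[x1 _]; apply: df'; exact: lt_trans x1.
have [x] := MVT u1 dfu cf.
rewrite in_itv/= => /andP[x1 xu] E.
have x0 : 0 < x by exact: lt_trans x1.
have d0 : 0 <= df x.
  have -> : df x = (x - 1) ^+ 2 / x by rewrite /df; field; rewrite gt_eqF.
  by rewrite divr_ge0 ?sqr_ge0// ltW.
have : 0 <= f (1 + u) - f 1 by rewrite E mulr_ge0// subr_ge0 ltW.
rewrite /f ln1; lra.
Qed.

(** Chernoff's bound at the exponent t = sqrt x / sqrt N; with
    log(1 + 2 t) >= 2 t - 2 t^2 the exponent is at most - 2 x + t^2 N = - x. *)
Lemma chi2_lower_tail (Q : pred I) (N x : R) :
  0 < N -> 0 <= x -> #|Q|%:R <= N ->
  (P [set w | 2 * Num.sqrt x * Num.sqrt N <= \sum_(i | Q i) (1 - z i w ^+ 2)]%R <=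
   (expR (- x))%:E)%E.
Proof.
move=> N0 x0 QN; pose m : R := #|Q|%:R; rewrite -/m in QN.
pose t := Num.sqrt x / Num.sqrt N.
have sN0 : 0 < Num.sqrt N by rewrite sqrtr_gt0.
have t0 : 0 <= t by rewrite divr_ge0 ?sqrtr_ge0.
pose X w := \sum_(i | Q i) (0 * z i w + (- t) * z i w ^+ 2).
have mX : measurable_fun setT X.
  by apply: (@measurable_sumz Q (fun i u => 0 * u + (- t) * u ^+ 2)) => i;
     apply: measurable_funD; exact: measurable_funM.
have XE w : t * \sum_(i | Q i) (1 - z i w ^+ 2) = t * m + X w.
  rewrite /m -sum1_card natr_sum [in t * _]mulr_sumr mulr_sumr -big_split/=.
  by apply: eq_bigr => i _; ring.
apply: (@le_trans _ _ (P [set w | 2 * x - t * m <= X w]%R)).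
  rewrite le_measure ?inE//.
  - apply: measurable_set_le => //.
    by apply: (@measurable_sumz Q (fun i u => 1 - u ^+ 2)) => i; exact: measurable_funB.
  - exact: measurable_set_le.
  - move=> w /= h; rewrite lerBlDl -XE.
    apply: le_trans (ler_wpM2l t0 h).
    apply: le_of_eq; rewrite /t.
    by rewrite -[in LHS](sqr_sqrtr x0); field; rewrite gt_eqF.
apply: (le_trans (prob_ge_le_expR _ mX (lexx _))).
have b2 : - t < 1 / 2 by apply: (@le_lt_trans _ _ 0); rewrite ?oppr_le0 ?divr_gt0.
rewrite (integral_expR_sumz (fun=> 0) Q (fun=> b2)).
rewrite -EFinM lee_fin expr0n mul0r expR0 mulr1 prodr_const -/m.
have -> : (Num.sqrt (1 - 2 * - t))^-1 ^+ #|Q| = expR (- (ln (1 + 2 * t) / 2 * m)).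
  rewrite -[- (_ * m)]mulNr /m expRM_natr expRN; congr (_^-1 ^+ _).
  have -> : 1 - 2 * - t = 1 + 2 * t by ring.
  have h0 : 0 < 1 + 2 * t by rewrite ltr_wpDr// mulr_ge0.
  rewrite -[X in Num.sqrt X]lnK ?posrE//.
  by rewrite -powR12_sqrt ?expR_ge0// -expRM.
rewrite -expRD ler_expR.
have h := @ln1D_ge (2 * t) (mulr_ge0 (ler0n _ 2) t0).
have m0 : 0 <= m by rewrite /m.
have t2 : t ^+ 2 * N = x.
  by rewrite /t expr_div_n !sqr_sqrtr// ?divfK ?gt_eqF// ltW.
have : t ^+ 2 * m <= x by rewrite -t2 ler_wpM2l ?sqr_ge0.
have : (2 * t - (2 * t) ^+ 2 / 2) * m <= ln (1 + 2 * t) * m by rewrite ler_wpM2r.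
by rewrite exprMn; lra.
Qed.

(** The variance of the sum is only bounded by s^2; a smaller variance is
    harmless because the quantile is positive for a < 1 / 2. *)
Lemma gaussian_sum_quantile (c : I -> R) (Q : pred I) (a s : R) :
  0 < a < 1 / 2 -> 0 <= s -> \sum_(i | Q i) c i ^+ 2 <= s ^+ 2 ->
  (P [set w | s * normal_upper a < \sum_(i | Q i) c i * z i w]%R <= a%:E)%E.
Proof.
move=> a12 s0 cs; have [za _] := normal_upperP a12.
have c0 : 0 <= \sum_(i | Q i) c i ^+ 2 by apply: sumr_ge0 => i _; exact: sqr_ge0.
move: c0; rewrite le_eqVlt => /predU1P[c0|c0].
  rewrite (_ : [set w | _] = set0) ?measure0.
    by rewrite lee_fin; case/andP: a12 => /ltW.
  apply/seteqP; split => // w /=; rewrite big1 => [|i Qi].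
    by rewrite ltNge mulr_ge0// ltW.
  move: c0 => /esym/eqP; rewrite psumr_eq0 => [/allP|j _]; last exact: sqr_ge0.
  move=> /(_ i); rewrite mem_index_enum => /(_ isT).
  by rewrite Qi sqrf_eq0 => /eqP ->; rewrite mul0r.
pose S := Num.sqrt (\sum_(i | Q i) c i ^+ 2).
have S0 : 0 < S by rewrite sqrtr_gt0.
have Ss : S <= s by rewrite -(ger0_norm s0) -sqrtr_sqr ler_sqrt// sqr_ge0.
rewrite -[X in (_ <= X)%E](normal_prob_upper_tail a12 S0).
have := psum_normal (c := c) iid (enum_uniq Q) (measurable_itv `]S * normal_upper a, +oo[).
rewrite big_enum => /(_ c0) <-.
have mS : measurable_fun setT (fun w => \sum_(i | Q i) c i * z i w).
  by apply: (@measurable_sumz Q (fun i u => c i * u)) => i; exact: measurable_funM.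
have -> : psum z (fun i u => c i * u) (enum Q) = fun w => \sum_(i | Q i) c i * z i w.
  by apply/funext => w; rewrite psum_enum.
rewrite le_measure ?inE//.
- exact: measurable_set_lt.
- by rewrite -[X in measurable X]setTI; exact: mS.
- move=> w /= h; rewrite in_itv/= andbT; apply: le_lt_trans h.
  by rewrite ler_pM2r.
Qed.

Lemma sqr_level (v u y : R) : (v + u) ^+ 2 = y ->
  u = Num.sqrt y - v \/ u = - Num.sqrt y - v.
Proof.
move=> <-; rewrite sqrtr_sqr; have [_|_] := ger0P (v + u); [left|right]; ring.
Qed.

(** Ties with the threshold are negligible: the estimator keeps a block at
    equality, the radius does not charge for it, and [block_loss_le] excludes it. *)
Lemma prob_noncentral_chi2_eq0 (v : I -> R) (Q : pred I) (i : I) (c : R) : Q i ->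
  P [set w | \sum_(i | Q i) (v i + z i w) ^+ 2 = c] = 0%E.
Proof.
move=> Qi; pose s := rem i (enum Q).
have sP : perm_eq (enum Q) (i :: s) by rewrite perm_to_rem// mem_enum.
have us : uniq (i :: s) by rewrite -(perm_uniq sP) enum_uniq.
pose g (i : I) (u : R) := (v i + u) ^+ 2.
have mg j : measurable_fun setT (g j).
  by apply: measurable_funX; exact: measurable_funD.
have : P [set w | psum z g (i :: s) w = c] = 0%E.
  apply: (prob_psum_eq0 iid) => // y.
  have [y0|y0] := ltP y 0.
    rewrite (_ : [set u | _] = set0) ?(@measure0 _ _ _ N01)//.
    by apply/seteqP; split => // u /= gu; move: y0; rewrite -gu ltNge sqr_ge0.
  apply/eqP; rewrite eq_le (@measure_ge0 _ _ _ N01) andbT.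
  apply: (@le_trans _ _ (N01 ([set Num.sqrt y - v i] `|` [set - Num.sqrt y - v i]))).
    apply: (@le_measure _ _ _ N01); rewrite ?inE.
    - have := mg i measurableT [set y] (measurable_set1 _).
      by rewrite setTI.
    - exact: measurableU.
    - by move=> u /= /sqr_level.
  have := @measureU2 _ _ _ N01 _ _ (measurable_set1 (Num.sqrt y - v i))
    (measurable_set1 (- Num.sqrt y - v i)).
  by move/le_trans; apply; rewrite /= !normal_prob_set1 adde0.
move=> <-; congr (P _); apply/seteqP; split => w /=;
  by rewrite /psum -(perm_big _ sP) big_enum.
Qed.

(** The cross term 4 v u (u^2 - 1) is absorbed by completing a square, so that only
    the moments of order 1, 2 and 4 are used. *)
Lemma integral_normal_score_sqr (v y : R) :
  (\int[N01]_u ((2 * v * u + (u ^+ 2 - 1) + y) ^+ 2)%:E <=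
   (y ^+ 2 + (32 * v ^+ 2 + 4))%:E)%E.
Proof.
(* p u - (2 v u + (u^2 - 1) + y)^2 = (14 v u - (u^2 - 1))^2 / 7; the weight 1 / 7
   makes the constant term 4 when the fourth moment is bounded by 9 / 2. *)
pose p (u : R) := (y ^+ 2 - 2 * y + 8 / 7) + 4 * y * v * u +
  (32 * v ^+ 2 + 2 * y - 16 / 7) * u ^+ 2 + 8 / 7 * u ^+ 4.
have ple u : (2 * v * u + (u ^+ 2 - 1) + y) ^+ 2 <= p u.
  rewrite -subr_ge0 (_ : _ - _ = 7^-1 * (14 * v * u - (u ^+ 2 - 1)) ^+ 2).
    by rewrite mulr_ge0 ?sqr_ge0.
  by rewrite /p; field.
have mq : measurable_fun setT (fun u : R => 2 * v * u + (u ^+ 2 - 1) + y).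
  apply: measurable_funD => //; apply: measurable_funD; first exact: measurable_funM.
  exact: measurable_funB.
have mp : measurable_fun setT p.
  apply: measurable_funD; last exact: measurable_funM.
  apply: measurable_funD; last exact: measurable_funM.
  by apply: measurable_funD => //; exact: measurable_funM.
apply: (@le_trans _ _ (\int[N01]_u (p u)%:E)%E).
  apply: ge0_le_integral => //.
  - by move=> u _; rewrite lee_fin sqr_ge0.
  - by apply/measurable_EFinP; exact: measurable_funX.
  - by apply/measurable_EFinP; exact: mp.
  - by move=> u _; rewrite lee_fin.
rewrite integral_normal_poly.
apply: (@le_trans _ _ ((y ^+ 2 - 2 * y + 8 / 7 + (32 * v ^+ 2 + 2 * y - 16 / 7))%:E +
  (8 / 7)%:E * (9 / 2)%:E)%E).
  by rewrite leeD2l// lee_wpmul2l ?integral_normal_pow4// lee_fin; lra.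
by rewrite -EFinM -EFinD lee_fin; lra.
Qed.

(** max 0 X <= (X + a)^2 / (4 a), since (X + a)^2 - 4 a X = (X - a)^2. *)
Lemma integral_score_max_le (v : I -> R) (Q : pred I) (a : R) : 0 < a ->
  (\int[P]_w (Num.max 0 (\sum_(i | Q i) (2 * v i * z i w + (z i w ^+ 2 - 1))))%:E <=
   ((a ^+ 2 + 32 * \sum_(i | Q i) v i ^+ 2 + 4 * #|Q|%:R) / (4 * a))%:E)%E.
Proof.
move=> a0; pose g (i : I) (u : R) := 2 * v i * u + (u ^+ 2 - 1).
have mg i : measurable_fun setT (g i).
  by apply: measurable_funD; [exact: measurable_funM|exact: measurable_funB].
have mS := measurable_sumz Q mg.
have a4 : 0 < (4 * a)^-1 by rewrite invr_gt0 mulr_gt0.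
have mS2 : measurable_fun setT (fun w => (\sum_(i | Q i) g i (z i w) + a) ^+ 2).
  by apply: measurable_funX; exact: measurable_funD.
apply: (@le_trans _ _ (\int[P]_w ((4 * a)^-1%:E * ((\sum_(i | Q i) g i (z i w) + a) ^+ 2)%:E))%E).
  apply: ge0_le_integral => //.
  - by move=> w _; rewrite lee_fin le_max lexx.
  - by apply/measurable_EFinP; apply: measurable_maxr.
  - by apply/measurable_EFinP; exact: measurable_funM.
  - move=> w _; rewrite -EFinM lee_fin ge_max mulr_ge0 ?sqr_ge0 ?(ltW a4)//=.
    rewrite -/(g _ _) mulrC ler_pdivlMr ?mulr_gt0//.
    move: (\sum_(i | Q i) _) => X; rewrite -subr_ge0.
    by rewrite (_ : _ - _ = (X - a) ^+ 2) ?sqr_ge0//; ring.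
rewrite ge0_integralZl//; last 3 first.
- exact/measurable_EFinP.
- by move=> w _; rewrite lee_fin sqr_ge0.
- by rewrite lee_fin ltW.
rewrite [X in (_ <= X%:E)%E]mulrC EFinM lee_pmul2l ?lte_fin//.
have -> : (\int[P]_w ((\sum_(i | Q i) g i (z i w) + a) ^+ 2)%:E =
           \int[P]_w ((psum z g (enum Q) w + a) ^+ 2)%:E)%E.
  by apply: eq_integral => w _; rewrite psum_enum.
pose V i := 32 * v i ^+ 2 + 4.
have V0 i : 0 <= V i by have := sqr_ge0 (v i); rewrite /V; lra.
have gV i y := integral_normal_score_sqr (v i) y.
apply: (le_trans (integral_psum_sqr_le iid a (enum_uniq Q) mg V0 gV)).
rewrite big_enum big_split/= -mulr_sumr sumr_const lee_fin.
by rewrite -[4 *+ _]mulr_natr addrA.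
Qed.
End tails.

(** * Blocks of coordinates *)

Section blocks.
Context (J L : nat) (d : nat -> nat).
Hypothesis L0 : (0 < L)%N.
Hypothesis dL : forall j : 'I_J, (L %| d j)%N.

Definition block_idx := {j : 'I_J & 'I_(d j %/ L)}.

Lemma blk_subproof (j : 'I_J) (k : 'I_(d j)) : (k %/ L < d j %/ L)%N.
Proof. by rewrite ltn_divLR// divnK. Qed.

Definition blk (x : coord_idx J d) : block_idx :=
  Tagged (fun j : 'I_J => 'I_(d j %/ L)) (Ordinal (blk_subproof (tagged x))).

Lemma blkE (x : coord_idx J d) (b : block_idx) :
  (blk x == b) = (tag x == tag b) && (tagged x %/ L == tagged b)%N.
Proof.
case: x b => [j k] [j' i] /=; have [jj|jj] := eqVneq j j'.
  by subst j'; rewrite /blk eq_Tagged.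
by apply/negbTE; apply: contraNneq jj => /(congr1 tag) /= ->.
Qed.

Lemma sum_blk (V : nmodType) (F : coord_idx J d -> V) (b : block_idx) :
  \sum_(x | blk x == b) F x =
  \sum_(k < d (tag b) | (k %/ L == tagged b)%N) F (at_level k).
Proof.
under eq_bigl do rewrite blkE.
transitivity (\sum_(j < J | j == tag b)
    \sum_(k < d j | (k %/ L == tagged b)%N) F (at_level k)).
  by rewrite sig_big_dep; apply: eq_bigr => -[].
by rewrite big_pred1_eq.
Qed.

Lemma sum_tag (V : nmodType) (F : coord_idx J d -> V) (j : 'I_J) :
  \sum_(x | tag x == j) F x = \sum_(k < d j) F (at_level k).
Proof.
transitivity (\sum_(i < J | i == j) \sum_(k < d i) F (at_level k)).
  by rewrite sig_big_dep; apply: eq_big => [x|[]//]; rewrite andbT.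
by rewrite big_pred1_eq.
Qed.

Lemma card_blk (b : block_idx) : #|[pred x | blk x == b]| = L.
Proof.
have -> : #|[pred x | blk x == b]| = (\sum_(x | blk x == b) 1)%N by rewrite sum1_card.
rewrite sum_blk sum1_card; case: b => j i /=.
have hk (l : 'I_L) : (i * L + l < d j)%N.
  apply: (@leq_trans (d j %/ L * L)); last by rewrite divnK.
  apply: (@leq_trans (i * L + L)); first by rewrite ltn_add2l.
  by rewrite -mulSnr leq_mul2r ltn_ord orbT.
pose h l := Ordinal (hk l).
have hinj : injective h by move=> l l' /(congr1 val)/= /addnI/val_inj.
rewrite -[RHS]card_ord -(card_codom hinj); apply: eq_card => k.
rewrite -[LHS]/(k %/ L == i)%N; apply/eqP/codomP => [ki|[l ->]] /=; last by rewrite divnMDl// (divn_small (ltn_ord l)) addn0.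
exists (Ordinal (ltn_pmod k L0)); apply: val_inj => /=.
by rewrite -ki -divn_eq.
Qed.

Lemma card_block_idx : (#|{: block_idx}| * L = ncoord J d)%N.
Proof.
rewrite card_tagged sumnE big_map big_enum/= big_distrl/=.
by apply: eq_bigr => j _; rewrite card_ord divnK.
Qed.

Lemma sum_blocks (V : nmodType) (F : coord_idx J d -> V) (A : pred block_idx) :
  \sum_(x | A (blk x)) F x = \sum_(b | A b) \sum_(x | blk x == b) F x.
Proof.
rewrite (partition_big blk A)//; apply: eq_bigr => b Ab; apply: eq_bigl => x.
by case: eqP => [->|]; rewrite ?Ab ?andbT ?andbF.
Qed.

Lemma card_coord_idx : #|{: coord_idx J d}| = ncoord J d.
Proof.
rewrite card_tagged sumnE big_map big_enum/=.
by apply: eq_bigr => j _; rewrite card_ord.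
Qed.
End blocks.

(** * A deterministic criterion for coverage *)

Section ball_criterion.
Variable R : realType.
Notation lam := (lambda_star R).

(** The loss on a block against the terms of the radius. Here Lr is the block size,
    and A says that the signal xi on the block is small. When the block is
    killed, A holds because xi <= 2 s + 2 chi <= 4 lam Lr. *)
Lemma block_loss_le (Lr xi m chi : R) (A := xi <= 4 * lam * Lr)
    (s := xi + 2 * m + chi) :
  0 <= Lr -> chi <= lam * Lr -> (A -> m <= 4 * Num.sqrt lam * Lr) ->
  s <> lam * Lr -> xi <= 2 * s + 2 * chi ->
  (if lam * Lr <= s then chi else xi) <=
  (s - Lr) * (s <= lam * Lr)%R%:R
  + (2 * lam + 8 * Num.sqrt lam - 1) * Lr * (lam * Lr < s)%R%:R
  + (if A then 2 * - m + (Lr - chi) else 0).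
Proof.
move=> Lr0 chil Am st tri; have [l1 _] := lambda_starP R.
have q0 := sqrtr_ge0 lam.
have qL : 0 <= Num.sqrt lam * Lr by rewrite mulr_ge0.
have lL : Lr <= lam * Lr by rewrite ler_peMl// ltW.
rewrite [s <= _]leNgt; have [sl|sl] := ltP (lam * Lr) s; rewrite ?(ltW sl) /=.
  rewrite mulr0 add0r mulr1; case: ifP => [/Am|_]; last by lra.
  by lra.
have {}sl : s < lam * Lr by rewrite lt_neqAle sl andbT; apply/eqP.
rewrite (leNgt (lam * Lr) s) sl/= mulr1 mulr0 addr0.
have -> : A by rewrite /A; lra.
by rewrite /s; lra.
Qed.

Context (J : nat) (d : nat -> nat) (n : R).
Notation L := (blocksize n).
Notation N := (ncoord J d).
Hypothesis n1 : 1 < n.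
Hypothesis L0 : (0 < L)%N.
Hypothesis dL : forall j : 'I_J, (L %| d j)%N.
Notation bk := (blk L0 dL).
Notation Lr := (L%:R : R).

Lemma S2_blk (y : coord_idx J d -> R) (b : block_idx J L d) :
  S2 L y (tag b) (tagged b) = \sum_(x | bk x == b) y x ^+ 2.
Proof. by rewrite sum_blk. Qed.

Lemma kept_blocksE (y : coord_idx J d -> R) :
  (kept_blocks n y)%:R =
  \sum_(b : block_idx J L d) (lam * Lr / n < S2 L y (tag b) (tagged b))%R%:R :> R.
Proof.
rewrite /kept_blocks -sum1_card natr_sum [LHS]big_mkcond/=; apply: eq_bigr => b _.
by rewrite inE; case: ifP.
Qed.

(** The positive part at each level is at least the sum over its blocks. *)
Lemma radius2_ge (alpha : R) (y : coord_idx J d -> R) :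
  (2 * Num.sqrt (ln (2 / alpha)) + 4 * Num.sqrt lam * normal_upper (alpha / 2))
    * Num.sqrt N%:R / n +
  \sum_(b : block_idx J L d)
    ((S2 L y (tag b) (tagged b) - Lr / n) *
       (S2 L y (tag b) (tagged b) <= lam * Lr / n)%R%:R
     + (2 * lam + 8 * Num.sqrt lam - 1) * Lr / n *
       (lam * Lr / n < S2 L y (tag b) (tagged b))%R%:R)
  <= radius2 n alpha y.
Proof.
rewrite big_split/= -mulr_sumr -kept_blocksE addrA /radius2 lerD2r lerD2l.
rewrite (_ : \sum_i _ = \sum_(j < J) \sum_(i < d j %/ L)
  (S2 L y j i - Lr / n) * (S2 L y j i <= lam * Lr / n)%R%:R).
  by apply: ler_sum => j _; rewrite le_max lexx orbT.
by rewrite sig_big_dep.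
Qed.

(** For v = sqrt n * theta. This is a condition on theta alone, so
    sums over small blocks have a fixed set of indices. *)
Definition small_block (v : coord_idx J d -> R) (b : block_idx J L d) : bool :=
  \sum_(x | bk x == b) v x ^+ 2 <= 4 * lam * Lr.

Lemma confidence_ballP (alpha : R) (theta zeta : coord_idx J d -> R)
    (v := fun x => Num.sqrt n * theta x)
    (y := fun x => theta x + zeta x / Num.sqrt n) :
  (forall b : block_idx J L d, \sum_(x | bk x == b) zeta x ^+ 2 <= lam * Lr) ->
  (forall b : block_idx J L d, small_block v b ->
     \sum_(x | bk x == b) v x * zeta x <= 4 * Num.sqrt lam * Lr) ->
  (forall b : block_idx J L d, \sum_(x | bk x == b) (v x + zeta x) ^+ 2 <> lam * Lr) ->
  \sum_(x | small_block v (bk x)) - v x * zeta x <=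
    2 * Num.sqrt lam * Num.sqrt N%:R * normal_upper (alpha / 2) ->
  \sum_(x | small_block v (bk x)) (1 - zeta x ^+ 2) <=
    2 * Num.sqrt (ln (2 / alpha)) * Num.sqrt N%:R ->
  confidence_ball n alpha y theta.
Proof.
move=> H1 H2 H3 H4 H5; have n0 : 0 < n by exact: lt_trans n1.
have sn0 : 0 < Num.sqrt n by rewrite sqrtr_gt0.
have sn2 : Num.sqrt n ^+ 2 = n by rewrite sqr_sqrtr// ltW.
rewrite /confidence_ball/= /l2norm; apply: ler_wsqrtr.
apply: le_trans (radius2_ge alpha y); rewrite -(ler_pM2r n0).
pose s (b : block_idx J L d) := \sum_(x | bk x == b) (v x + zeta x) ^+ 2.
have sn_neq0 : Num.sqrt n != 0 by rewrite gt_eqF.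
have y2E x : y x ^+ 2 = (v x + zeta x) ^+ 2 / n.
  transitivity ((v x + zeta x) ^+ 2 / Num.sqrt n ^+ 2); last by rewrite sn2.
  by rewrite /y /v; field.
have keptE x : (theta x - y x) ^+ 2 * n = zeta x ^+ 2.
  transitivity ((theta x - y x) ^+ 2 * Num.sqrt n ^+ 2); first by rewrite sn2.
  by rewrite /y; field.
have S2E (b : block_idx J L d) : S2 L y (tag b) (tagged b) = s b / n.
  rewrite S2_blk mulr_suml; apply: eq_bigr => x _.
  exact: y2E.
pose xi (b : block_idx J L d) := \sum_(x | bk x == b) v x ^+ 2.
pose m (b : block_idx J L d) := \sum_(x | bk x == b) v x * zeta x.
pose chi (b : block_idx J L d) := \sum_(x | bk x == b) zeta x ^+ 2.
have sE (b : block_idx J L d) : s b = xi b + 2 * m b + chi b.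
  rewrite /s /xi /m /chi mulr_sumr -!big_split/=; apply: eq_bigr => x _; ring.
have lossE : (\sum_x (theta x - theta_hat n y x) ^+ 2) * n =
    \sum_(b : block_idx J L d) (if lam * Lr <= s b then chi b else xi b).
  rewrite (sum_blocks L0 dL _ xpredT) mulr_suml; apply: eq_bigr => b _.
  case: ifP => sb; rewrite mulr_suml; apply: eq_bigr => x /eqP xb.
    rewrite /theta_hat -[S2 _ _ _ _]/(S2 L y (tag (bk x)) (tagged (bk x))) xb S2E.
    rewrite ler_pM2r ?invr_gt0// sb mulr1.
    exact: keptE.
  rewrite /theta_hat -[S2 _ _ _ _]/(S2 L y (tag (bk x)) (tagged (bk x))) xb S2E.
  by rewrite ler_pM2r ?invr_gt0// sb mulr0 subr0 /v exprMn sn2 mulrC.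
(* K collects the deterministic part of the radius; it pays for the credits of the
   small blocks. *)
rewrite lossE; set K := _ + 4 * _ * _.
apply: (@le_trans _ _ (\sum_(b : block_idx J L d) ((s b - Lr) * (s b <= lam * Lr)%R%:R
  + (2 * lam + 8 * Num.sqrt lam - 1) * Lr * (lam * Lr < s b)%R%:R
  + (if small_block v b then 2 * - m b + (Lr - chi b) else 0)))).
  apply: ler_sum => b _; rewrite sE /small_block -/(xi b).
  apply: block_loss_le => //.
  - exact: H1.
  - exact: H2.
  - by rewrite -sE; exact: H3.
  - rewrite -sE /xi /s /chi !mulr_sumr -big_split/=; apply: ler_sum => x _.
    rewrite -subr_ge0 (_ : _ - _ = (v x + 2 * zeta x) ^+ 2) ?sqr_ge0//; ring.
rewrite big_split/= [X in X <= _]addrC [X in _ <= X]mulrDl; apply: lerD; last first.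
  rewrite mulr_suml; apply: ler_sum => b _; rewrite S2E.
  rewrite ler_pM2r ?invr_gt0// ltr_pM2r ?invr_gt0//.
  apply: le_of_eq; field.
  by rewrite gt_eqF.
rewrite -big_mkcond/= divfK ?gt_eqF//.
have -> : \sum_(b | small_block v b) (2 * - m b + (Lr - chi b)) =
  2 * (\sum_(x | small_block v (bk x)) - v x * zeta x) +
  \sum_(x | small_block v (bk x)) (1 - zeta x ^+ 2).
  rewrite !(sum_blocks L0 dL _ (small_block v)) mulr_sumr -big_split/=.
  apply: eq_bigr => b _; congr (_ + _).
    by rewrite /m -sumrN; congr (_ * _); apply: eq_bigr => x _; rewrite mulNr.
  rewrite sumrB /chi; congr (_ - _).
  by rewrite sumr_const (card_blk L0 dL).
rewrite /K [X in _ <= X]mulrDl [X in X <= _]addrC; apply: lerD => //.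
apply: le_trans (ler_wpM2l (ler0n R 2) H4) _.
by apply: le_of_eq; ring.
Qed.
End ball_criterion.

(** * Measurability of the radius and of the coverage event *)

Section ball_measurability.
Context disp (T : measurableType disp) (R : realType) (P : probability T R).

Lemma prob_bigcup_le (B : finType) (E : B -> set T) : (forall b, measurable (E b)) ->
  (P (\bigcup_(b in [set: B]) E b) <= \sum_(b : B) P (E b))%E.
Proof.
move=> mE; have -> : \bigcup_(b in [set: B]) E b = \big[setU/set0]_(b <- index_enum B) E b.
  rewrite -bigcup_seq; apply/seteqP; split => w [b _ Ebw]; exists b => //=.
  by rewrite mem_index_enum.
elim: (index_enum B) => [|b s IH]; first by rewrite !big_nil measure0.
rewrite !big_cons; apply: le_trans (leeD2l _ IH).
by apply: measureU2 => //; exact: bigsetU_measurable.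
Qed.

Lemma prob_setU_le (A B : set T) (a b : R) : measurable A -> measurable B ->
  (P A <= a%:E)%E -> (P B <= b%:E)%E -> (P (A `|` B) <= (a + b)%:E)%E.
Proof.
move=> mA mB Pa Pb; rewrite EFinD; apply: le_trans (leeD Pa Pb).
exact: measureU2.
Qed.

Lemma measurable_le_indic (f g : T -> R) :
  measurable_fun setT f -> measurable_fun setT g ->
  measurable_fun setT (fun w => (f w <= g w)%R%:R : R).
Proof.
move=> mf mg; have -> : (fun w => (f w <= g w)%R%:R : R) = \1_[set w | f w <= g w].
  apply/funext => w; rewrite indicE; congr (nat_of_bool _)%:R.
  by apply/idP/idP; rewrite inE.
by apply: measurable_indic; exact: measurable_set_le.
Qed.

Lemma measurable_lt_indic (f g : T -> R) :
  measurable_fun setT f -> measurable_fun setT g ->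
  measurable_fun setT (fun w => (f w < g w)%R%:R : R).
Proof.
move=> mf mg; have -> : (fun w => (f w < g w)%R%:R : R) = \1_[set w | f w < g w].
  apply/funext => w; rewrite indicE; congr (nat_of_bool _)%:R.
  by apply/idP/idP; rewrite inE.
by apply: measurable_indic; exact: measurable_set_lt.
Qed.

Context (J : nat) (d : nat -> nat) (z : coord_idx J d -> {RV P >-> R}).
Context (n : R) (theta : coord_idx J d -> R).
Notation L := (blocksize n).
Notation N := (ncoord J d).
Notation lam := (lambda_star R).
Notation Lr := (L%:R : R).
Notation y := (obs n theta z).

Lemma measurable_sum_cond (I : finType) (Q : pred I) (f : I -> T -> R) :
  (forall i, measurable_fun setT (f i)) ->
  measurable_fun setT (fun w => \sum_(i | Q i) f i w).
Proof.
move=> mf; under eq_fun do rewrite big_mkcond.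
by apply: measurable_sum => i; case: (Q i).
Qed.

Lemma measurable_obs x : measurable_fun setT (fun w => y w x).
Proof. by apply: measurable_funD => //; exact: measurable_funM. Qed.

Lemma measurable_S2 (j : 'I_J) i : measurable_fun setT (fun w => S2 L (y w) j i).
Proof.
by apply: measurable_sum_cond => k; apply: measurable_funX; exact: measurable_obs.
Qed.

Lemma measurable_theta_hat x : measurable_fun setT (fun w => theta_hat n (y w) x).
Proof.
apply: measurable_funM; first exact: measurable_obs.
by apply: measurable_le_indic => //; exact: measurable_S2.
Qed.

Lemma measurable_radius2 alpha : measurable_fun setT (fun w => radius2 n alpha (y w)).
Proof.
apply: measurable_funD; last first.
  apply: measurable_funM => //; under eq_fun do rewrite kept_blocksE.
  apply: measurable_sum => b; apply: measurable_lt_indic => //.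
  exact: measurable_S2.
apply: measurable_funD => //; apply: measurable_sum => j.
apply: measurable_maxr => //; apply: measurable_sum => i.
apply: measurable_funM; first by apply: measurable_funB => //; exact: measurable_S2.
by apply: measurable_le_indic => //; exact: measurable_S2.
Qed.

Lemma measurable_confidence_ball alpha :
  measurable [set w | confidence_ball n alpha (y w) theta].
Proof.
have msqrt : measurable_fun setT (@Num.sqrt R).
  by apply: continuous_measurable_fun; exact: sqrt_continuous.
apply: measurable_set_le; (apply: measurableT_comp; first exact: msqrt).
  apply: measurable_sum => x; apply: measurable_funX; apply: measurable_funB => //.
  exact: measurable_theta_hat.
exact: measurable_radius2.
Qed.
End ball_measurability.

(** * Coverage probability *)

Section coverage_bound.
Context disp (T : measurableType disp) (R : realType) (P : probability T R).
Context (J : nat) (d : nat -> nat) (z : coord_idx J d -> {RV P >-> R}).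
Context (n : R).
Notation L := (blocksize n).
Notation N := (ncoord J d).
Notation lam := (lambda_star R).
Notation Lr := (L%:R : R).
Hypothesis n1 : 1 < n.
Hypothesis dL : forall j : 'I_J, (L %| d j)%N.
Hypothesis iid : iid_std_normal z.
Hypothesis Nn : N%:R <= n ^+ 2.

Lemma ln_n_gt0 : 0 < ln n. Proof. by rewrite ln_gt0. Qed.

Lemma blocksize_ge : ln n <= Lr.
Proof.
have c0 : (0 <= Num.ceil (ln n))%R.
  by rewrite ceil_ge0 (lt_trans _ ln_n_gt0)// ltrN10.
rewrite /blocksize -[X in _ <= X](_ : (Num.ceil (ln n))%:~R = _); first exact: ceil_ge.
by rewrite -[in LHS](gez0_abs c0).
Qed.

Lemma blocksize_lt : Lr < ln n + 1.
Proof.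
have c0 : (0 <= Num.ceil (ln n))%R.
  by rewrite ceil_ge0 (lt_trans _ ln_n_gt0)// ltrN10.
have -> : Lr = (Num.ceil (ln n))%:~R by rewrite -[in RHS](gez0_abs c0).
have /andP[+ _] := ceil_itv (ln n); rewrite intrB; lra.
Qed.

Lemma blocksize_gt0 : (0 < L)%N.
Proof. by rewrite -(ltr_nat R) (lt_le_trans ln_n_gt0) ?blocksize_ge. Qed.
Notation L0 := blocksize_gt0.
Notation bk := (blk L0 dL).

Lemma expR_blocksize_le : expR (- 2 * Lr) <= (n ^+ 2)^-1.
Proof.
have n0 : 0 < n by exact: lt_trans n1.
rewrite mulNr expRN lef_pV2 ?posrE ?expR_gt0 ?exprn_gt0//.
rewrite -[X in X ^+ 2](lnK n0) -expRM_natl ler_expR ler_wpM2l//.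
exact: blocksize_ge.
Qed.

Lemma card_block_boundE : #|{: block_idx J L d}|%:R * Lr = N%:R.
Proof. by rewrite -natrM card_block_idx. Qed.

Lemma sum_small_block (v : coord_idx J d -> R) :
  \sum_(x | small_block L0 dL v (bk x)) v x ^+ 2 <= 4 * lam * N%:R.
Proof.
rewrite (sum_blocks L0 dL _ (small_block L0 dL v)) -card_block_boundE.
have [l1 _] := lambda_starP R.
apply: (@le_trans _ _ (\sum_(b : block_idx J L d) 4 * lam * Lr)).
  rewrite big_mkcond; apply: ler_sum => b _; case: ifP => // _.
  by rewrite !mulr_ge0// ltW// (lt_trans ltr01).
by rewrite sumr_const -mulr_natr; apply: le_of_eq; ring.
Qed.

(** Union bound over the failure of each hypothesis of [confidence_ballP]. *)
Lemma coverage_ge (theta : coord_idx J d -> R) (alpha : R) : 0 < alpha < 1 ->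
  ((1 - alpha - 2 / ln n)%:E <=
   P [set w | confidence_ball n alpha (obs n theta z w) theta])%E.
Proof.
move=> /andP[a0 a1]; have [l1 lE] := lambda_starP R.
have l0 : 0 < lam by exact: lt_trans l1.
have n0 : 0 < n by exact: lt_trans n1.
have ln0 := ln_n_gt0; have Lge := blocksize_ge.
have Lr0 : 0 < Lr by rewrite ltr0n blocksize_gt0.
pose v x := Num.sqrt n * theta x.
pose A b := small_block L0 dL v b.
pose s := 2 * Num.sqrt lam * Num.sqrt N%:R.
have a12 : 0 < alpha / 2 < 1 / 2 by apply/andP; split; [rewrite divr_gt0|lra].
pose E1 (b : block_idx J L d) : set T := [set w | lam * Lr <= \sum_(x | bk x == b) z x w ^+ 2].
pose E2 (b : block_idx J L d) : set T := [set w | A b /\ 4 * Num.sqrt lam * Lr <= \sum_(x | bk x == b) v x * z x w].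
pose E3 (b : block_idx J L d) : set T := [set w | \sum_(x | bk x == b) (v x + z x w) ^+ 2 = lam * Lr].
pose E4 : set T := [set w | s * normal_upper (alpha / 2) < \sum_(x | A (bk x)) - v x * z x w].
pose E5 : set T := [set w | 2 * Num.sqrt (ln (2 / alpha)) * Num.sqrt N%:R < \sum_(x | A (bk x)) (1 - z x w ^+ 2)].
have mz x : measurable_fun setT (z x) by [].
have mE1 b : measurable (E1 b).
  apply: measurable_set_le => //; apply: measurable_sum_cond => x.
  exact: measurable_funX.
have mE2 b : measurable (E2 b).
  rewrite /E2; case: (A b); last by rewrite (_ : [set w | _] = set0)//; apply/seteqP; split => // w [].
  rewrite (_ : [set w | _] = [set w | 4 * Num.sqrt lam * Lr <= \sum_(x | bk x == b) v x * z x w]).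
    apply: measurable_set_le => //; apply: measurable_sum_cond => x.
    exact: measurable_funM.
  by apply/seteqP; split => w //= [].
have mE3 b : measurable (E3 b).
  have mf : measurable_fun setT (fun w => \sum_(x | bk x == b) (v x + z x w) ^+ 2).
    by apply: measurable_sum_cond => x; apply: measurable_funX; exact: measurable_funD.
  by rewrite -[X in measurable X]setTI; exact: (mf measurableT [set lam * Lr]).
have mE4 : measurable E4.
  apply: measurable_set_lt => //; apply: measurable_sum_cond => x.
  exact: measurable_funM.
have mE5 : measurable E5.
  apply: measurable_set_lt => //; apply: measurable_sum_cond => x.
  by apply: measurable_funB => //; exact: measurable_funX.
have PE1 b : (P (E1 b) <= ((n ^+ 2)^-1)%:E)%E.
  have := noncentral_chi2_tail iid (fun=> 0) [pred x | bk x == b] l1 lE.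
  rewrite card_blk expr0n/= big1// mulr0 addr0.
  under eq_set do under eq_bigr do rewrite add0r.
  by move/le_trans; apply; rewrite lee_fin expR_blocksize_le.
have PE2 b : (P (E2 b) <= ((n ^+ 2)^-1)%:E)%E.
  have [Ab|nAb] := boolP (A b); last first.
    rewrite (_ : E2 b = set0) ?measure0 ?lee_fin ?invr_ge0 ?sqr_ge0//.
    by apply/seteqP; split => // w []; rewrite (negbTE nAb).
  have V0 : 0 < 4 * lam * Lr by rewrite !mulr_gt0.
  have t0 : 0 <= 4 * Num.sqrt lam * Lr by rewrite !mulr_ge0// ?sqrtr_ge0// ltW.
  have := gaussian_sum_tail iid V0 t0 Ab.
  have -> : (4 * Num.sqrt lam * Lr) ^+ 2 / (2 * (4 * lam * Lr)) = 2 * Lr.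
    rewrite !exprMn sqr_sqrtr ?(ltW l0)//; field.
    by rewrite !gt_eqF.
  rewrite -mulNr => /le_trans h; apply: le_trans (h _ _); last first.
    by rewrite lee_fin expR_blocksize_le.
  rewrite le_measure ?inE//.
    apply: measurable_set_le => //; apply: measurable_sum_cond => x.
    exact: measurable_funM.
  by move=> w [].
have PE3 b : P (E3 b) = 0%E.
  have /card_gt0P[x] : (0 < #|[pred x | bk x == b]|)%N by rewrite card_blk blocksize_gt0.
  rewrite inE => xb; exact: (prob_noncentral_chi2_eq0 iid (Q := fun x => bk x == b) _ _ xb).
have PE4 : (P E4 <= (alpha / 2)%:E)%E.
  have s0 : 0 <= s by rewrite !mulr_ge0 ?sqrtr_ge0.
  apply: (gaussian_sum_quantile iid (c := fun x => - v x)
    (Q := fun x => A (bk x)) a12 s0).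
  under eq_bigr do rewrite sqrrN.
  rewrite /s !exprMn !sqr_sqrtr ?ler0n ?(ltW l0)//.
  by apply: le_trans (sum_small_block v) _; apply: le_of_eq; ring.
have PE5 : (P E5 <= (alpha / 2)%:E)%E.
  have [N0|N0] := posnP N.
    rewrite (_ : E5 = set0) ?measure0 ?lee_fin; first by case/andP: a12 => /ltW.
    apply/seteqP; split => // w; rewrite /E5/= N0 sqrtr0 mulr0 big1 ?ltxx// => x _.
    have := card_coord_idx J d; rewrite N0 => /card0_eq/(_ x); rewrite inE//.
  have x0 : 0 <= ln (2 / alpha).
    by rewrite ln_ge0// ler_pdivlMr// mul1r; lra.
  have Nr0 : 0 < N%:R :> R by rewrite ltr0n.
  have cQ : #|[pred x | A (bk x)]|%:R <= N%:R :> R.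
    by rewrite ler_nat -(card_coord_idx J d) max_card.
  have := chi2_lower_tail iid Nr0 x0 cQ.
  have -> : expR (- ln (2 / alpha)) = alpha / 2.
    by rewrite expRN lnK ?posrE ?divr_gt0// invf_div.
  apply: le_trans; rewrite le_measure ?inE//.
    apply: measurable_set_le => //; apply: measurable_sum_cond => x.
    by apply: measurable_funB => //; exact: measurable_funX.
  by move=> w /ltW.
pose Bad : set T := (\bigcup_(b in [set: block_idx J L d]) E1 b) `|`
  (\bigcup_(b in [set: block_idx J L d]) E2 b) `|`
  (\bigcup_(b in [set: block_idx J L d]) E3 b) `|` E4 `|` E5.
have mU (E : block_idx J L d -> set T) : (forall b, measurable (E b)) ->
    measurable (\bigcup_(b in [set: block_idx J L d]) E b).
  by move=> mE; apply: fin_bigcup_measurable => //; exact: finite_finset.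
have mBad : measurable Bad by do ?apply: measurableU => //; exact: mU.
have PBad : (P Bad <= (alpha + 2 / ln n)%:E)%E.
  have kle : #|{: block_idx J L d}|%:R * (n ^+ 2)^-1 <= (ln n)^-1.
    apply: (@le_trans _ _ (Lr^-1)); last by rewrite lef_pV2 ?posrE.
    by rewrite ler_pdivrMr ?exprn_gt0// ler_pdivlMl// mulrC card_block_boundE.
  have kU (E : block_idx J L d -> set T) : (forall b, measurable (E b)) ->
      (forall b, P (E b) <= ((n ^+ 2)^-1)%:E)%E ->
      (P (\bigcup_(b in [set: block_idx J L d]) E b) <= ((ln n)^-1)%:E)%E.
    move=> mE PE; apply: le_trans (prob_bigcup_le P mE) _.
    apply: (@le_trans _ _ (\sum_(b : block_idx J L d) ((n ^+ 2)^-1)%:E)%E).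
      by apply: lee_sum => b _.
    by rewrite sumEFin sumr_const -mulr_natl lee_fin.
  have U3 : P (\bigcup_(b in [set: block_idx J L d]) E3 b) = 0%E.
    apply/eqP; rewrite eq_le measure_ge0 andbT.
    by apply: le_trans (prob_bigcup_le P mE3) _; rewrite big1.
  have -> : alpha + 2 / ln n = (ln n)^-1 + (ln n)^-1 + 0 + alpha / 2 + alpha / 2.
    by field; rewrite gt_eqF.
  have m12 := measurableU _ _ (mU _ mE1) (mU _ mE2).
  have m123 := measurableU _ _ m12 (mU _ mE3).
  have m1234 := measurableU _ _ m123 mE4.
  apply: prob_setU_le => //; apply: prob_setU_le => //.
  apply: prob_setU_le => //; [exact: mU| |by rewrite U3].
  by apply: prob_setU_le; rewrite ?kU//; exact: mU.
have sub : ~` Bad `<=` [set w | confidence_ball n alpha (obs n theta z w) theta].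
  move=> w nb; apply: (confidence_ballP n1 (L0 := L0) (dL := dL) (zeta := fun x => z x w)).
  - move=> b; rewrite leNgt; apply/negP => h; apply: nb; do 4 left; exists b => //.
    exact: ltW.
  - move=> b Ab; rewrite leNgt; apply/negP => h; apply: nb; do 3 left; right; exists b => //.
    by split => //; exact: ltW.
  - by move=> b h; apply: nb; do 2 left; right; exists b.
  - by rewrite leNgt; apply/negP => h; apply: nb; left; right.
  - by rewrite leNgt; apply/negP => h; apply: nb; right.
have mball := measurable_confidence_ball z n theta alpha.
apply: (@le_trans _ _ (P (~` Bad))); last by rewrite le_measure ?inE//; exact: measurableC.
rewrite probability_setC// -addrA -opprD EFinB.
by rewrite leeB.
Qed.
End coverage_bound.

(** * Expected squared radius at a fixed parameter *)

Section expected_radius.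
Context disp (T : measurableType disp) (R : realType) (P : probability T R).

Lemma ge0_integral_sum_EFin (I : finType) (Q : pred I) (f : I -> T -> R) :
  (forall i, measurable_fun setT (f i)) -> (forall i w, 0 <= f i w) ->
  (\int[P]_w (\sum_(i | Q i) f i w)%:E = \sum_(i | Q i) \int[P]_w (f i w)%:E)%E.
Proof.
move=> mf f0; rewrite -big_filter -ge0_integral_sum//.
- by apply: eq_integral => w _; rewrite -big_filter sumEFin.
- by move=> i; exact/measurable_EFinP.
- by move=> i w _; rewrite lee_fin.
Qed.

(** If w = k V >= L then w / L >= 1. Otherwise exp w <= 1 + w exp w <= 1 + w exp L
    and exp(- L) <= 1 / L. *)
Lemma min1_expR_le (L V k : R) : 0 < L -> 0 <= V -> 0 <= k ->
  Num.min 1 (expR (- 2 * L + k * V)) <= expR (- 2 * L) + k * V / L.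
Proof.
move=> L0 V0 k0; set w := k * V; have w0 : 0 <= w by rewrite mulr_ge0.
have [Lw|wL] := leP L w.
  rewrite ge_min; apply/orP; left; apply: ler_wpDl; first exact: expR_ge0.
  by rewrite ler_pdivlMr// mul1r.
rewrite ge_min; apply/orP; right; rewrite expRD.
have h1 : expR w <= 1 + w * expR w.
  have := expR_ge1Dx (- w); rewrite expRN => h.
  have := expR_gt0 w => e0; have := ler_wpM2r (ltW e0) h.
  by rewrite mulVf ?gt_eqF//; lra.
have h2 : expR w <= expR L by rewrite ler_expR ltW.
have h3 : expR (- 2 * L) * expR L <= L^-1.
  rewrite -expRD (_ : - 2 * L + L = - L); last ring.
  rewrite expRN lef_pV2 ?posrE ?expR_gt0//.
  by apply: le_trans (expR_ge1Dx L); rewrite lerDr.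
have e0 := expR_ge0 (- 2 * L).
have h4 : w * expR w <= w * expR L by rewrite ler_wpM2l.
have h5 : expR (- 2 * L) * expR w <= expR (- 2 * L) * (1 + w * expR L).
  by rewrite ler_wpM2l//; lra.
have h6 : w * (expR (- 2 * L) * expR L) <= w * L^-1 by rewrite ler_wpM2l.
by apply: le_trans h5 _; lra.
Qed.

Context (J : nat) (d : nat -> nat) (z : coord_idx J d -> {RV P >-> R}).
Context (n : R).
Notation L := (blocksize n).
Notation N := (ncoord J d).
Notation lam := (lambda_star R).
Notation Lr := (L%:R : R).
Hypothesis n1 : 1 < n.
Hypothesis dL : forall j : 'I_J, (L %| d j)%N.
Hypothesis iid : iid_std_normal z.
Notation L0 := (blocksize_gt0 n1).
Notation bk := (blk L0 dL).
Context (theta : coord_idx J d -> R) (alpha : R).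
Hypothesis a01 : 0 < alpha < 1.
Notation y := (obs n theta z).
Notation v := (fun x => Num.sqrt n * theta x).
Notation K0 := (2 * Num.sqrt (ln (2 / alpha)) + 4 * Num.sqrt lam * normal_upper (alpha / 2)).
Notation K1 := (2 * lam + 8 * Num.sqrt lam - 1).

Lemma K1_ge0 : 0 <= K1.
Proof. by have [l1 _] := lambda_starP R; have := sqrtr_ge0 lam; lra. Qed.

Lemma K0_ge0 : 0 <= K0.
Proof.
have a12 : 0 < alpha / 2 < 1 / 2.
  by case/andP: a01 => a0 a1; apply/andP; split; [rewrite divr_gt0|lra].
have [/ltW za _] := normal_upperP a12.
by rewrite addr_ge0// ?mulr_ge0// sqrtr_ge0.
Qed.

Lemma n_gt0 : 0 < n. Proof. exact: lt_trans n1. Qed.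

Lemma natr_level (j : 'I_J) : (d j)%:R = (d j %/ L)%:R * Lr.
Proof. by rewrite -natrM divnK. Qed.

Lemma sqr_obs w x : y w x ^+ 2 = (v x + z x w) ^+ 2 / n.
Proof.
have sn2 : Num.sqrt n ^+ 2 = n by rewrite sqr_sqrtr// ltW// n_gt0.
transitivity ((v x + z x w) ^+ 2 / Num.sqrt n ^+ 2); last by rewrite sn2.
by rewrite /obs; field; rewrite gt_eqF// sqrtr_gt0 n_gt0.
Qed.

Lemma S2_normalized w (b : block_idx J L d) :
  S2 L (y w) (tag b) (tagged b) = (\sum_(x | bk x == b) (v x + z x w) ^+ 2) / n.
Proof.
rewrite (S2_blk L0 dL) mulr_suml; apply: eq_bigr => x _; exact: sqr_obs.
Qed.

Lemma sum_level_S2 w (j : 'I_J) :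
  \sum_(i < d j %/ L) S2 L (y w) j i = \sum_(x | tag x == j) y w x ^+ 2.
Proof.
rewrite sum_tag /S2; symmetry.
by rewrite (partition_big (fun k => Ordinal (blk_subproof L0 dL k)) xpredT).
Qed.

Lemma radius2_ge0 w : 0 <= radius2 n alpha (y w).
Proof.
rewrite /radius2 !addr_ge0//.
- by rewrite divr_ge0 ?mulr_ge0 ?K0_ge0 ?sqrtr_ge0// ltW// n_gt0.
- by apply: sumr_ge0 => j _; rewrite le_max lexx.
- by rewrite !mulr_ge0 ?K1_ge0 ?invr_ge0// ltW// n_gt0.
Qed.

(** For the short levels: a killed block contributes at most the threshold. *)
Lemma level_term_le_size w (j : 'I_J) :
  Num.max 0 (\sum_(i < d j %/ L)
    (S2 L (y w) j i - Lr / n) * (S2 L (y w) j i <= lam * Lr / n)%R%:R) <=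
  lam * (d j)%:R / n.
Proof.
have [l1 _] := lambda_starP R; have n0 := n_gt0.
have l0 : 0 < lam by exact: lt_trans l1.
rewrite ge_max !mulr_ge0 ?invr_ge0 ?(ltW l0) ?(ltW n0)//=.
apply: (@le_trans _ _ (\sum_(i < d j %/ L) lam * Lr / n)).
  apply: ler_sum => i _; have [h|h] := leP (S2 L (y w) j i) (lam * Lr / n); rewrite ?mulr1 ?mulr0.
    by rewrite lerBlDr; apply: ler_wpDr => //; rewrite divr_ge0// ltW.
  by rewrite !mulr_ge0 ?invr_ge0// ltW.
rewrite sumr_const card_ord -[_ *+ (d j %/ L)]mulr_natr natr_level.
by apply: le_of_eq; ring.
Qed.

(** For the long levels: dropping the indicators only increases the sum, because a
    kept block has S2 - L / n > 0, and n S2 - L is xi plus a centred variable. *)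
Lemma level_term_le_energy w (j : 'I_J) :
  Num.max 0 (\sum_(i < d j %/ L)
    (S2 L (y w) j i - Lr / n) * (S2 L (y w) j i <= lam * Lr / n)%R%:R) <=
  \sum_(x | tag x == j) theta x ^+ 2 +
  n^-1 * Num.max 0 (\sum_(x | tag x == j) (2 * v x * z x w + (z x w ^+ 2 - 1))).
Proof.
have [l1 _] := lambda_starP R; have n0 := n_gt0.
have sn2 : Num.sqrt n ^+ 2 = n by rewrite sqr_sqrtr// ltW.
set Z := \sum_(x | tag x == j) (2 * _ * _ + _).
have t0 : 0 <= \sum_(x | tag x == j) theta x ^+ 2 by apply: sumr_ge0 => x _; exact: sqr_ge0.
have Z0 : 0 <= n^-1 * Num.max 0 Z by rewrite mulr_ge0 ?invr_ge0 ?(ltW n0)// le_max lexx.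
rewrite ge_max addr_ge0//=.
apply: (@le_trans _ _ (\sum_(i < d j %/ L) (S2 L (y w) j i - Lr / n))).
  apply: ler_sum => i _; have [h|h] := leP (S2 L (y w) j i) (lam * Lr / n); rewrite ?mulr1 ?mulr0//.
  rewrite subr_ge0; apply: le_trans (ltW h).
  by rewrite ler_pM2r ?invr_gt0// ler_peMl// ltW.
apply: (@le_trans _ _ (\sum_(x | tag x == j) theta x ^+ 2 + n^-1 * Z)); last first.
  by rewrite lerD2l ler_wpM2l ?invr_ge0 ?(ltW n0)// le_max lexx orbT.
rewrite sumrB sum_level_S2 sumr_const card_ord -[_ *+ (d j %/ L)]mulr_natr.
have -> : Lr / n * (d j %/ L)%:R = \sum_(x : coord_idx J d | tag x == j) n^-1.
  by rewrite sum_tag sumr_const card_ord -[RHS]mulr_natr natr_level; ring.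
rewrite -sumrB mulr_sumr -big_split/=; apply: ler_sum => x _; apply: le_of_eq.
rewrite sqr_obs -[theta x](mulKf (x := Num.sqrt n)) ?gt_eqF ?sqrtr_gt0//.
rewrite exprMn exprVn sn2; field.
by rewrite !gt_eqF ?sqrtr_gt0.
Qed.

Lemma prob_kept_le (b : block_idx J L d) :
  (P [set w | (lam * Lr <= \sum_(x | bk x == b) (v x + z x w) ^+ 2)%R] <=
   (expR (- 2 * Lr) + (lam - 1) / 2 * (\sum_(x | bk x == b) v x ^+ 2) / Lr)%:E)%E.
Proof.
have [l1 lE] := lambda_starP R.
have Lr0 : 0 < Lr by rewrite ltr0n blocksize_gt0.
have V0 : 0 <= \sum_(x | bk x == b) v x ^+ 2 by apply: sumr_ge0 => x _; exact: sqr_ge0.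
have k0 : 0 <= (lam - 1) / 2 by lra.
apply: (@le_trans _ _ (Num.min 1 (expR (- 2 * Lr + (lam - 1) / 2 * \sum_(x | bk x == b) v x ^+ 2)))%:E);
  last by rewrite lee_fin; exact: min1_expR_le.
have := noncentral_chi2_tail iid v [pred x | bk x == b] l1 lE.
rewrite card_blk => h; rewrite EFin_min le_min h andbT.
apply: probability_le1; apply: measurable_set_le => //.
by apply: measurable_sum_cond => x; apply: measurable_funX; exact: measurable_funD.
Qed.

Lemma sum_block_levels (Q : pred 'I_J) (c : R) :
  \sum_(b : block_idx J L d | Q (tag b)) c * Lr = \sum_(j | Q j) c * (d j)%:R.
Proof.
transitivity (\sum_(j | Q j) \sum_(i < d j %/ L) c * Lr).
  by rewrite sig_big_dep; apply: eq_bigl => b; rewrite andbT.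
apply: eq_bigr => j _; rewrite sumr_const card_ord -[LHS]mulr_natr natr_level; ring.
Qed.

Lemma sum_level_coords (Q : pred 'I_J) (F : coord_idx J d -> R) :
  \sum_(b : block_idx J L d | Q (tag b)) \sum_(x | bk x == b) F x =
  \sum_(j | Q j) \sum_(x | tag x == j) F x.
Proof.
rewrite -(sum_blocks L0 dL F (fun b => Q (tag b))).
rewrite (partition_big (fun x : coord_idx J d => tag x) Q)//=.
apply: eq_bigr => j Qj; apply: eq_bigl => x.
by case: eqP => [->|]; rewrite ?Qj ?andbF.
Qed.

(** The set hi of levels is arbitrary: outside it the radius is bounded by the
    sizes of the levels, inside it by the energy of theta. *)
Lemma expected_radius2_le (hi : pred 'I_J) :
  (forall j, hi j -> (0 < d j)%N) ->
  ('E_P[fun w => radius2 n alpha (y w)] <=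
   (K0 * Num.sqrt N%:R / n
    + \sum_(j | hi j) Num.sqrt (d j)%:R / n
    + (lam + K1) * \sum_(j | ~~ hi j) (d j)%:R / n
    + (5 + K1 * ((lam - 1) / 2)) *
        \sum_(j | hi j) \sum_(x | tag x == j) theta x ^+ 2
    + K1 * (N%:R / n * expR (- 2 * Lr)))%:E)%E.
Proof.
move=> dhi; have [l1 lE] := lambda_starP R; have n0 := n_gt0.
have l0 : 0 < lam by exact: lt_trans l1.
have Lr0 : 0 < Lr by rewrite ltr0n blocksize_gt0.
have sn2 : Num.sqrt n ^+ 2 = n by rewrite sqr_sqrtr// ltW.
pose xi2 (j : 'I_J) := \sum_(x : coord_idx J d | tag x == j) theta x ^+ 2.
pose c0 := K0 * Num.sqrt N%:R / n + (lam + K1) * \sum_(j | ~~ hi j) (d j)%:R / n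
  + \sum_(j | hi j) xi2 j.
pose F (j : 'I_J) w := n^-1 * Num.max 0 (\sum_(x : coord_idx J d | tag x == j) (2 * v x * z x w + (z x w ^+ 2 - 1))).
pose G (b : block_idx J L d) w : R := K1 * Lr / n * (lam * Lr <= \sum_(x | bk x == b) (v x + z x w) ^+ 2)%R%:R.
have c00 : 0 <= c0.
  rewrite /c0 !addr_ge0// ?mulr_ge0 ?K0_ge0 ?sqrtr_ge0 ?invr_ge0 ?(ltW n0)//.
  - by rewrite addr_ge0 ?K1_ge0// ltW.
  - by apply: sumr_ge0 => j _; rewrite divr_ge0// ltW.
  - by apply: sumr_ge0 => j _; apply: sumr_ge0 => x _; exact: sqr_ge0.
have K1n : 0 <= K1 * Lr / n by rewrite !mulr_ge0 ?K1_ge0 ?invr_ge0// ltW.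
have mF j : measurable_fun setT (F j).
  apply: measurable_funM => //; apply: measurable_maxr => //.
  apply: measurable_sum_cond => x; apply: measurable_funD; first exact: measurable_funM.
  by apply: measurable_funB => //; exact: measurable_funX.
have mG b : measurable_fun setT (G b).
  apply: measurable_funM => //; apply: measurable_le_indic => //.
  by apply: measurable_sum_cond => x; apply: measurable_funX; exact: measurable_funD.
have F0 j w : 0 <= F j w by rewrite mulr_ge0 ?invr_ge0 ?(ltW n0)// le_max lexx.
have G0 b w : 0 <= G b w by rewrite mulr_ge0.
have ub w : radius2 n alpha (y w) <=
    c0 + (\sum_(j | hi j) F j w + \sum_(b : block_idx J L d | hi (tag b)) G b w).
  rewrite /radius2 kept_blocksE.
  have hM : \sum_(j < J) Num.max 0 (\sum_(i < d j %/ L)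
      (S2 L (y w) j i - Lr / n) * (S2 L (y w) j i <= lam * Lr / n)%R%:R) <=
      (\sum_(j | hi j) xi2 j + \sum_(j | hi j) F j w) +
      lam * \sum_(j | ~~ hi j) (d j)%:R / n.
    rewrite (bigID hi)/= -big_split mulr_sumr/=; apply: lerD; apply: ler_sum => j _.
      exact: level_term_le_energy.
    by rewrite mulrA; exact: level_term_le_size.
  have hK : K1 * Lr / n * \sum_(b : block_idx J L d)
      (lam * Lr / n < S2 L (y w) (tag b) (tagged b))%R%:R <=
      \sum_(b : block_idx J L d | hi (tag b)) G b w +
      K1 * \sum_(j | ~~ hi j) (d j)%:R / n.
    rewrite mulr_sumr (bigID (fun b : block_idx J L d => hi (tag b)))/=.
    apply: lerD.
      apply: ler_sum => b _; rewrite S2_normalized ltr_pM2r ?invr_gt0// /G.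
      rewrite ler_wpM2l// ler_nat; case: ltP => // h.
      by rewrite (ltW h).
    apply: (@le_trans _ _ (\sum_(b : block_idx J L d | ~~ hi (tag b)) K1 / n * Lr)).
      apply: ler_sum => b _; apply: (@le_trans _ _ (K1 * Lr / n)).
        by apply: ler_piMr => //; case: (_ < _).
      by apply: le_of_eq; ring.
    rewrite (sum_block_levels (fun j => ~~ hi j)) mulr_sumr.
    by apply: ler_sum => j _; apply: le_of_eq; ring.
  apply: le_trans (lerD (lerD (lexx _) hM) hK) _.
  by apply: le_of_eq; rewrite /c0; ring.
have mFs : measurable_fun setT (fun w => \sum_(j | hi j) F j w).
  exact: measurable_sum_cond.
have mGs : measurable_fun setT (fun w => \sum_(b : block_idx J L d | hi (tag b)) G b w).
  exact: measurable_sum_cond.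
rewrite unlock; apply: (@le_trans _ _ (\int[P]_w (c0%:E + ((\sum_(j | hi j) F j w)%:E +
    (\sum_(b : block_idx J L d | hi (tag b)) G b w)%:E)))%E).
  apply: ge0_le_integral => //.
  - by move=> w _; rewrite lee_fin radius2_ge0.
  - by apply/measurable_EFinP; exact: measurable_radius2.
  - apply: emeasurable_funD => //; apply: emeasurable_funD; exact/measurable_EFinP.
  - by move=> w _; rewrite -!EFinD lee_fin.
have Fs0 w : (0 <= (\sum_(j | hi j) F j w)%:E)%E by rewrite lee_fin sumr_ge0.
have Gs0 w : (0 <= (\sum_(b : block_idx J L d | hi (tag b)) G b w)%:E)%E.
  by rewrite lee_fin sumr_ge0.
rewrite ge0_integralD//; last 2 first.
- by move=> w _; rewrite adde_ge0.
- by apply: emeasurable_funD; exact/measurable_EFinP.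
rewrite ge0_integralD//; last 2 first.
- exact/measurable_EFinP.
- exact/measurable_EFinP.
rewrite integral_prob_cst !ge0_integral_sum_EFin//.
have IF j : hi j -> (\int[P]_w (F j w)%:E <= (Num.sqrt (d j)%:R / n + 4 * xi2 j)%:E)%E.
  move=> /dhi dj0; have dj1 : 1 <= (d j)%:R :> R by rewrite ler1n.
  have sd1 : 1 <= Num.sqrt (d j)%:R :> R by rewrite -[X in X <= _]sqrtr1 ler_sqrt// ler01.
  have sd0 : 0 < Num.sqrt (d j)%:R :> R by exact: lt_le_trans sd1.
  have a0 : 0 < 2 * Num.sqrt (d j)%:R :> R by rewrite mulr_gt0.
  have h := integral_score_max_le iid v [pred x | tag x == j] a0.
  have nV0 : 0 <= n^-1 by rewrite invr_ge0 ltW.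
  under eq_integral do rewrite EFinM.
  rewrite ge0_integralZl//; last 2 first.
  - apply/measurable_EFinP; apply: measurable_maxr => //.
    apply: measurable_sum_cond => x; apply: measurable_funD; first exact: measurable_funM.
    by apply: measurable_funB => //; exact: measurable_funX.
  - by move=> w _; rewrite lee_fin le_max lexx.
  apply: le_trans (lee_wpmul2l _ h) _; first by rewrite lee_fin.
  rewrite -EFinM lee_fin.
  have -> : #|[pred x : coord_idx J d | tag x == j]| = d j.
    by rewrite -sum1_card (sum_tag (fun=> 1%N)) sum1_card card_ord.
  have -> : \sum_(x : coord_idx J d | [pred x | tag x == j] x) (Num.sqrt n * theta x) ^+ 2 = n * xi2 j.
    by rewrite /xi2 mulr_sumr; apply: eq_bigr => x _; rewrite exprMn sn2.
  set q := Num.sqrt (d j)%:R.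
  have qq : (d j)%:R = q ^+ 2 by rewrite sqr_sqrtr.
  rewrite qq.
  have -> : n^-1 * (((2 * q) ^+ 2 + 32 * (n * xi2 j) + 4 * q ^+ 2) / (4 * (2 * q))) =
     q / n + 4 * xi2 j / q.
    by field; rewrite !gt_eqF.
  rewrite lerD2l ler_pdivrMr// ler_peMr// mulr_ge0//.
  by apply: sumr_ge0 => x _; exact: sqr_ge0.
have IG b : (\int[P]_w (G b w)%:E <= (K1 * expR (- 2 * Lr) / n * Lr +
    K1 * ((lam - 1) / 2) * \sum_(x | bk x == b) theta x ^+ 2)%:E)%E.
  under eq_integral do rewrite EFinM.
  have mE : measurable [set w | lam * Lr <= \sum_(x | bk x == b) (v x + z x w) ^+ 2].
    apply: measurable_set_le => //.
    by apply: measurable_sum_cond => x; apply: measurable_funX; exact: measurable_funD.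
  rewrite ge0_integralZl//; last first.
    apply/measurable_EFinP; apply: measurable_le_indic => //.
    by apply: measurable_sum_cond => x; apply: measurable_funX; exact: measurable_funD.
  apply: (@le_trans _ _ ((K1 * Lr / n)%:E * P [set w | (lam * Lr <= \sum_(x | bk x == b) (v x + z x w) ^+ 2)%R])%E).
    rewrite lee_wpmul2l ?lee_fin// -integral_prob_indic//.
    apply: le_of_eq; apply: eq_integral => w _; congr (_%:E).
    rewrite indicE; congr (nat_of_bool _)%:R.
    by apply/idP/idP; rewrite inE.
  apply: le_trans (lee_wpmul2l _ (prob_kept_le b)) _; first by rewrite lee_fin.
  rewrite -EFinM lee_fin.
  have -> : \sum_(x | bk x == b) (Num.sqrt n * theta x) ^+ 2 =
      n * \sum_(x | bk x == b) theta x ^+ 2.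
    by rewrite mulr_sumr; apply: eq_bigr => x _; rewrite exprMn sn2.
  by apply: le_of_eq; field; rewrite !gt_eqF.
have SF : (\sum_(j | hi j) \int[P]_w (F j w)%:E <=
    (\sum_(j | hi j) Num.sqrt (d j)%:R / n + 4 * \sum_(j | hi j) xi2 j)%:E)%E.
  by rewrite mulr_sumr -big_split -sumEFin; apply: lee_sum => j; exact: IF.
have SG : (\sum_(b : block_idx J L d | hi (tag b)) \int[P]_w (G b w)%:E <=
    (K1 * (N%:R / n * expR (- 2 * Lr)) + K1 * ((lam - 1) / 2) * \sum_(j | hi j) xi2 j)%:E)%E.
  apply: (@le_trans _ _ (\sum_(b : block_idx J L d | hi (tag b))
      (K1 * expR (- 2 * Lr) / n * Lr +
       K1 * ((lam - 1) / 2) * \sum_(x | bk x == b) theta x ^+ 2)%:E)%E).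
    by apply: lee_sum => b _; exact: IG.
  rewrite sumEFin lee_fin big_split/= (sum_block_levels hi) -[X in _ + X <= _]mulr_sumr (sum_level_coords hi).
  rewrite lerD2r -mulr_sumr.
  apply: (@le_trans _ _ (K1 * expR (- 2 * Lr) / n * N%:R)).
    rewrite ler_wpM2l ?mulr_ge0 ?K1_ge0 ?expR_ge0 ?invr_ge0 ?(ltW n0)//.
    rewrite /ncoord natr_sum [X in X <= _]big_mkcond; apply: ler_sum => j _.
    by case: ifP.
  by apply: le_of_eq; ring.
apply: (le_trans (leeD2l _ (leeD SF SG))).
rewrite -!EFinD lee_fin /c0 -/xi2.
have x20 : 0 <= \sum_(j | hi j) xi2 j.
  by apply: sumr_ge0 => j _; apply: sumr_ge0 => x _; exact: sqr_ge0.
by apply: le_of_eq; rewrite /xi2; ring.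
Qed.
End expected_radius.

(** * Sums over dyadic levels *)

Section sums.
Variable R : realType.

(** Peeling off the power 0 rescales the threshold q by 1 / r. *)
Lemma geometric_tail (r : R) (m : nat) (q : R) : 0 < r < 1 -> 0 <= q ->
  \sum_(j < m | r ^+ j <= q) r ^+ j <= q / (1 - r).
Proof.
move=> /andP[r0 r1]; have r10 : 0 < 1 - r by rewrite subr_gt0.
have tot k : \sum_(j < k) r ^+ j <= (1 - r)^-1.
  rewrite -[X in _ <= X]mul1r ler_pdivlMr// mulrC.
  have -> : (1 - r) * \sum_(j < k) r ^+ j = 1 - r ^+ k.
    by rewrite -[RHS]opprB subrX1 -mulNr opprB.
  by rewrite gerBl exprn_ge0// ltW.
elim: m q => [|m IH] q q0; first by rewrite big_ord0 divr_ge0// ltW.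
have [q1|q1] := leP 1 q.
  apply: (@le_trans _ _ (1 - r)^-1); last by rewrite ler_pdivlMr// mulVf ?gt_eqF.
  apply: le_trans (tot m.+1); rewrite big_mkcond; apply: ler_sum => j _.
  by case: ifP => // _; rewrite exprn_ge0// ltW.
rewrite big_mkcond big_ord_recl expr0 (leNgt 1 q) q1/= add0r.
have := IH (q / r) (divr_ge0 q0 (ltW r0)).
rewrite -(ler_pM2l r0) mulr_sumr => h.
rewrite -(_ : r * (q / r / (1 - r)) = q / (1 - r)); last first.
  by field; rewrite !gt_eqF.
apply: le_trans h; rewrite [X in _ <= X]big_mkcond; apply: ler_sum => j _.
by rewrite /bump/= exprS -ler_pdivlMl// [r^-1 * _]mulrC.
Qed.

Lemma dyadic_sum_le (Q : R) (m : nat) : 0 <= Q ->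
  \sum_(j < m | (2 ^ j)%:R <= Q) (2 ^ j)%:R <= 2 * Q.
Proof.
move=> Q0; elim: m => [|m IH]; first by rewrite big_ord0 mulr_ge0.
rewrite big_mkcond big_ord_recr/= -big_mkcond/=; case: ifP => h; last by rewrite addr0.
have tot k : \sum_(j < k) (2 ^ j)%:R <= (2 ^ k)%:R :> R.
  elim: k => [|k IHk]; first by rewrite big_ord0.
  by rewrite big_ord_recr/= expnS mul2n -addnn natrD lerD2r.
have : \sum_(j < m | (2 ^ j)%:R <= Q) (2 ^ j)%:R <= (2 ^ m)%:R :> R.
  apply: le_trans (tot m); rewrite big_mkcond; apply: ler_sum => j _.
  by case: ifP.
by lra.
Qed.

(** Since j < 2^j. *)
Lemma count_pow2_lt (m k : nat) : (\sum_(j < m | (2 ^ j < k)%N) 1 <= k)%N.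
Proof.
elim: m => [|m IH]; first by rewrite big_ord0.
rewrite big_mkcond big_ord_recr/= -big_mkcond/=; case: ifP => h; last by rewrite addn0.
apply: (@leq_trans (m + 1)); last by rewrite addn1 (leq_trans _ h)// ltnS ltnW// ltn_expl.
rewrite leq_add2r; apply: (@leq_trans (\sum_(j < m) 1)).
  by rewrite [X in (X <= _)%N]big_mkcond; apply: leq_sum => j _; case: ifP.
by rewrite sum_nat_const card_ord muln1.
Qed.

Section levels.
Context (J L : nat) (d : nat -> nat).
Hypothesis L0 : (0 < L)%N.
Hypothesis dy : dyadic_sizes J L d.

Lemma size_le_twice j : (j < J)%N -> (16 * L <= 2 ^ j)%N -> (d j <= 2 * 2 ^ j)%N.
Proof. by move=> /dy[_ h _]; lia. Qed.

Lemma size_ge_half j : (j < J)%N -> (16 * L <= 2 ^ j)%N -> (2 ^ j <= 2 * d j)%N.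
Proof. by move=> /dy[_ _ h]; lia. Qed.

(** As L <= 2^j / 16, the two sizes are at most 17/16 and at least 31/16 times 2^j,
    and 31 / 17 > 16 / 9. *)
Lemma size_growth j : (j.+1 < J)%N -> (16 * L <= 2 ^ j)%N -> (16 * d j <= 9 * d j.+1)%N.
Proof.
move=> jJ h; have [_ h1 _] := dy (ltnW jJ); have [_ _ h2] := dy jJ.
by move: h2; rewrite expnS; lia.
Qed.

(** The sizes grow by a factor of at least 16 / 9, so their square roots grow by
    at least 4 / 3, and the sum is at most 1 / (1 - 3 / 4) = 4 times its last
    term. This factor 4 is the one that the theorem displays. *)
Lemma sum_sqrt_levels (hi : pred nat) :
  (forall j, hi j -> (16 * L <= 2 ^ j)%N) -> (forall j, hi j -> hi j.+1) ->
  \sum_(j < J | hi j) Num.sqrt (d j)%:R <= 4 * Num.sqrt (ncoord J d)%:R :> R.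
Proof.
move=> hiL hiS.
have up j m : hi j -> (j <= m)%N -> hi m.
  move=> hj; elim: m => [|m IH]; first by rewrite leqn0 => /eqP <-.
  by rewrite leq_eqVlt => /predU1P[<-//|/IH]; exact: hiS.
have empty m : ~~ hi m -> \sum_(j < m.+1 | hi j) Num.sqrt (d j)%:R = 0 :> R.
  move=> hm; rewrite big1// => j hj; exfalso; move/negP: hm; apply.
  by apply: up hj _; rewrite -ltnS.
have claim m : (m < J)%N -> hi m ->
    \sum_(j < m.+1 | hi j) Num.sqrt (d j)%:R <= 4 * Num.sqrt (d m)%:R :> R.
  elim: m => [|m IH] mJ him.
    rewrite big_mkcond big_ord1/= him.
    by have := sqrtr_ge0 ((d 0)%:R : R); lra.
  rewrite big_mkcond big_ord_recr/= -big_mkcond/= him.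
  have s0 := sqrtr_ge0 ((d m.+1)%:R : R).
  have [hm|/empty ->] := boolP (hi m); last by rewrite add0r; lra.
  have h := IH (ltnW mJ) hm.
  have g : 4 * Num.sqrt (d m)%:R <= 3 * Num.sqrt (d m.+1)%:R :> R.
    rewrite -ler_sqr ?nnegrE ?mulr_ge0 ?sqrtr_ge0// !exprMn !sqr_sqrtr//.
    have := size_growth mJ (hiL _ hm); rewrite -(ler_nat R) !natrM; lra.
  by lra.
rewrite /ncoord; case: J claim => [_|m claim]; first by rewrite [X in X <= _]big_ord0 mulr_ge0 ?sqrtr_ge0.
have [hm|/empty ->] := boolP (hi m); last by rewrite mulr_ge0 ?sqrtr_ge0.
apply: le_trans (claim m _ hm) _ => //; rewrite ler_pM2l// ler_wsqrtr// ler_nat.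
by rewrite big_ord_recr/= leq_addl.
Qed.

End levels.
End sums.

(** * Energy of one level of a Besov body *)

Section besov_levels.
Variable R : realType.

(** x^2 = x^p x^(2 - p), where x^(2 - p) <= c^(2 - p) for x >= c as p >= 2. This
    replaces Holder's inequality between the norms of order 2 and p. *)
Lemma sqr_le_powR (p c x : R) : 2 <= p -> 0 < c -> 0 <= x ->
  x ^+ 2 <= c ^+ 2 + x `^ p * c `^ (2 - p).
Proof.
move=> p2 c0 x0; have [xc|cx] := leP x c.
  rewrite -[leLHS]addr0 lerD ?mulr_ge0 ?powR_ge0// ler_sqr ?nnegrE//.
  exact: ltW.
have x0' : 0 < x by exact: lt_trans cx.
rewrite -[leLHS]add0r lerD ?sqr_ge0//.
rewrite -(powR_mulrn 2 x0) -{1}(subrKC p 2) powRD; last by rewrite (gt_eqF x0') implybT.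
rewrite ler_wpM2l ?powR_ge0// -(opprB p 2) !powRN lef_pV2 ?posrE ?powR_gt0//.
by rewrite ge0_ler_powR ?nnegrE ?subr_ge0 ?(ltW c0) ?(ltW cx).
Qed.

Lemma besov_level (J : nat) (d : nat -> nat) (tau p q M : R)
    (theta : coord_idx J d -> R) (j : 'I_J) :
  1 <= q -> besov tau p q M theta ->
  2 `^ (j%:R * (tau + 1 / 2 - 1 / p)) *
    (\sum_(k < d j) `|theta (at_level k)| `^ p) `^ (1 / p) <= M.
Proof.
move=> q1.
pose a (i : 'I_J) := 2 `^ (i%:R * (tau + 1 / 2 - 1 / p)) *
  (\sum_(k < d i) `|theta (at_level k)| `^ p) `^ (1 / p).
change ((\sum_(i < J) a i `^ q) `^ (1 / q) <= M -> a j <= M).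
have a0 i : 0 <= a i by rewrite mulr_ge0 ?powR_ge0.
apply: le_trans.
have q0 : 0 < q by exact: lt_le_trans q1.
have aq i : 0 <= a i `^ q by exact: powR_ge0.
have aE : a j = (a j `^ q) `^ (1 / q).
  by rewrite -powRrM mul1r mulfV ?gt_eqF// powRr1.
rewrite aE.
apply: ge0_ler_powR; rewrite ?nnegrE ?divr_ge0 ?sumr_ge0 ?(ltW q0)//.
by rewrite (bigD1 j)/= ?lerDl ?sumr_ge0.
Qed.

(** Apply [sqr_le_powR] with c^p the largest average of |theta|^p over 2^j
    coordinates that the Besov constraint allows; then 2^j c^2 is
    M^2 2^(- 2 j tau), whatever p is. The factor 3 is 2 + 1, as the level has at
    most 2 * 2^j coordinates. *)
Lemma besov_level_energy (J : nat) (d : nat -> nat) (tau p q M : R)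
    (theta : coord_idx J d -> R) (j : 'I_J) :
  2 <= p -> 1 <= q -> 0 < M -> (d j <= 2 * 2 ^ j)%N -> besov tau p q M theta ->
  \sum_(k < d j) theta (at_level k) ^+ 2 <= 3 * (M ^+ 2 * (2 `^ (- (2 * tau))) ^+ j).
Proof.
move=> p2 q1 M0 dj /(besov_level j q1).
have p0 : 0 < p by exact: lt_le_trans p2.
set s := tau + 1 / 2 - 1 / p; set S := \sum_(k < d j) _ => h.
have S0 : 0 <= S by apply: sumr_ge0 => k _; exact: powR_ge0.
(* 2^j coordinates of modulus c exhaust the Besov constraint. *)
pose c := M * 2 `^ (- (j%:R * s)) * 2 `^ (- (j%:R / p)).
have c0 : 0 < c by rewrite !mulr_gt0 ?powR_gt0.
have Sc : S <= c `^ p * 2 ^+ j.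
  have : S `^ (1 / p) <= c * 2 `^ (j%:R / p).
    rewrite /c powRN powRN -mulrA mulVf ?mulr1 ?gt_eqF ?powR_gt0//.
    by rewrite ler_pdivlMr ?powR_gt0// mulrC.
  move/(ge0_ler_powR (ltW p0)); rewrite !nnegrE powR_ge0 mulr_ge0 ?powR_ge0 ?(ltW c0)//.
  move=> /(_ isT isT); rewrite -powRrM mul1r mulVf ?gt_eqF// powRr1//.
  rewrite powRM ?powR_ge0 ?(ltW c0)// -powRrM mulfVK ?gt_eqF//.
  by rewrite powR_mulrn.
apply: (@le_trans _ _ ((3 * 2 ^+ j) * c ^+ 2)); last first.
  rewrite -mulrA ler_wpM2l//; apply: le_of_eq.
  have e (x : R) m : (2 `^ x) ^+ m = 2 `^ (x * m%:R).
    by rewrite -powR_mulrn ?powR_ge0// -powRrM.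
  rewrite /c !exprMn !e -(@powR_mulrn _ 2 j)//.
  rewrite mulrC -mulrA -mulrA; congr (_ * _).
  rewrite -!powRD ?pnatr_eq0 ?implybT//.
  by congr (_ `^ _); rewrite /s; field; rewrite gt_eqF.
apply: (@le_trans _ _ (\sum_(k < d j) (c ^+ 2 + `|theta (at_level k)| `^ p * c `^ (2 - p)))).
  apply: ler_sum => k _; rewrite -[_ ^+ 2]real_normK ?num_real//.
  exact: sqr_le_powR.
rewrite big_split/= sumr_const card_ord -mulr_suml -/S.
have cc : c `^ p * c `^ (2 - p) = c ^+ 2.
  by rewrite -powRD ?subrKC ?powR_mulrn ?(ltW c0)// (gt_eqF c0) implybT.
have h1 : S * c `^ (2 - p) <= 2 ^+ j * c ^+ 2.
  by rewrite -cc mulrA [_ * c `^ p]mulrC ler_wpM2r ?powR_ge0.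
have h2 : c ^+ 2 *+ d j <= 2 * 2 ^+ j * c ^+ 2.
  rewrite -[c ^+ 2 *+ d j]mulr_natl ler_wpM2r ?sqr_ge0//.
  by rewrite -natrX -natrM ler_nat.
by have := lerD h2 h1; lra.
Qed.
End besov_levels.

(** * The rate and its cutoff *)

Section rate.
Context (R : realType) (tau n M : R).
Hypothesis tau0 : 0 < tau.
Hypothesis n1 : 1 < n.
Hypothesis M1 : 1 <= M.

Definition besov_rate : R :=
  M `^ (2 / (1 + 2 * tau)) * n `^ (- (2 * tau) / (1 + 2 * tau)).

(** The level size at which the noise of a level, its size over n, reaches the rate. *)
Definition cutoff : R := n * besov_rate.

Let n0 : 0 < n. Proof. exact: lt_trans n1. Qed.
Let M0 : 0 < M. Proof. exact: lt_le_trans M1. Qed.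
Let t0 : 0 < 1 + 2 * tau. Proof. by move: tau0; lra. Qed.

Lemma energy_ratio_itv : 0 < (2 : R) `^ (- (2 * tau)) < 1.
Proof.
rewrite powR_gt0//= powRN invf_lt1 ?powR_gt0// -[ltLHS](powRr0 2).
by rewrite /powR gt_eqF// ltr_expR mul0r !mulr_gt0// ln_gt0// ltr1n.
Qed.

Lemma besov_rate_gt0 : 0 < besov_rate.
Proof. by rewrite mulr_gt0 ?powR_gt0. Qed.

Lemma cutoff_ge : n `^ (1 + 2 * tau)^-1 <= cutoff.
Proof.
have -> : (1 + 2 * tau)^-1 = 1 + - (2 * tau) / (1 + 2 * tau).
  by field; rewrite gt_eqF.
rewrite powRD ?(gt_eqF n0) ?implybT// powRr1 ?(ltW n0)// ler_wpM2l ?(ltW n0)//.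
rewrite ler_peMl ?powR_ge0// -[leLHS](powRr0 M) ler_powR//.
by rewrite divr_ge0// ltW.
Qed.

Lemma cutoff_ge1 : 1 <= cutoff.
Proof.
apply: le_trans cutoff_ge; rewrite -[leLHS](powRr0 n) ler_powR ?(ltW n1)//.
by rewrite invr_ge0 ltW.
Qed.

(** The cutoff balances bias and noise: M^2 Q^(- 2 tau) = Q / n. *)
Lemma cutoff_pow : M ^+ 2 * cutoff `^ (- (2 * tau)) = besov_rate.
Proof.
have c0 : 0 < cutoff by exact: lt_le_trans cutoff_ge1.
rewrite powRN; apply: (canLR (mulfK _)); first by rewrite gt_eqF ?powR_gt0.
have x0 := ltW besov_rate_gt0.
rewrite /cutoff powRM ?(ltW n0)// mulrCA.
rewrite -[X in _ * (X * _)](powRr1 x0) -powRD; last by rewrite gt_eqF ?implybT// besov_rate_gt0.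
rewrite /besov_rate powRM ?powR_ge0// -!powRrM.
rewrite mulrCA -powRD ?(gt_eqF n0) ?implybT// !divfK ?gt_eqF// subrr powRr0 mulr1.
by rewrite powR_mulrn// ltW.
Qed.

(** exp x >= 1 + x at x = log n / (2 (1 + 2 tau)). *)
Lemma sqr_log_le : (ln n + 1) ^+ 2 <= (2 * (1 + 2 * tau)) ^+ 2 * cutoff.
Proof.
have ln0 : 0 < ln n by rewrite ln_gt0.
apply: (@le_trans _ _ ((2 * (1 + 2 * tau)) ^+ 2 * n `^ (1 + 2 * tau)^-1)); last first.
  by rewrite ler_wpM2l ?sqr_ge0 ?cutoff_ge.
set e := (1 + 2 * tau)^-1.
have -> : n `^ e = (expR (e / 2 * ln n)) ^+ 2.
  rewrite -expRM_natl /powR gt_eqF//; congr expR; by field.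
have tt0 : 0 <= 2 * (1 + 2 * tau) by move: t0; lra.
rewrite -exprMn ler_sqr ?nnegrE ?(mulr_ge0 tt0) ?expR_ge0 ?(addr_ge0 (ltW ln0))//.
apply: (@le_trans _ _ (2 * (1 + 2 * tau) * (1 + e / 2 * ln n))).
  rewrite mulrDr mulr1 mulrA; have -> : 2 * (1 + 2 * tau) * (e / 2) = 1.
    by rewrite /e; field; rewrite gt_eqF.
  by move: tau0; lra.
by rewrite ler_wpM2l// expR_ge1Dx.
Qed.

Context (J L : nat) (d : nat -> nat).
Hypothesis Ln : L%:R <= ln n + 1.
Hypothesis dy : dyadic_sizes J L d.
Hypothesis L0 : (0 < L)%N.

(** The second condition makes the rounding of the level sizes to multiples of L
    negligible. *)
Definition high_level (j : nat) := (cutoff < (2 ^ j)%:R) && (16 * L <= 2 ^ j)%N.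

Lemma high_level_succ j : high_level j -> high_level j.+1.
Proof.
move=> /andP[h1 h2]; apply/andP; split.
  by apply: lt_le_trans h1 _; rewrite ler_nat leq_exp2l.
by apply: leq_trans h2 _; rewrite leq_exp2l.
Qed.

(** A level that is not high has 2^j <= Q, and then size at most 2 * 2^j if
    2^j >= 16 L, or it has 2^j < 16 L, and then size below 17 L; there are at most
    16 L levels of the latter kind. *)
Lemma sum_low_levels : \sum_(j < J | ~~ high_level j) (d j)%:R <=
  (4 + 16 * 17 * (2 * (1 + 2 * tau)) ^+ 2) * cutoff.
Proof.
have Q0 : 0 <= cutoff by apply: le_trans cutoff_ge1.
apply: (@le_trans _ _ (\sum_(j < J | (2 ^ j)%:R <= cutoff) (2 * (2 ^ j)%:R)
    + \sum_(j < J | (2 ^ j < 16 * L)%N) (17 * L)%:R)).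
  rewrite [leLHS]big_mkcond [X in _ <= X + _]big_mkcond [X in _ <= _ + X]big_mkcond.
  rewrite -big_split; apply: ler_sum => j _ /=.
  have [_ h _] := dy (ltn_ord j).
  rewrite /high_level negb_and -leNgt -ltnNge.
  have [l1|l1] := leP (2 ^ j)%:R cutoff; have [l2|l2] := ltnP (2 ^ j) (16 * L) => //=.
  - rewrite -natrM -natrD ler_nat; lia.
  - rewrite addr0 -natrM ler_nat; lia.
  - rewrite add0r ler_nat; lia.
rewrite -mulr_sumr (mulrDl 4) lerD//.
  by have := @dyadic_sum_le R cutoff J Q0; lra.
rewrite -natr_sum.
apply: (@le_trans _ _ (16 * L * (17 * L))%:R).
  rewrite ler_nat; have := @count_pow2_lt J (16 * L).
  by rewrite sum1_card sum_nat_const => h; rewrite leq_mul2r h orbT.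
rewrite !natrM; apply: (@le_trans _ _ (16 * 17 * (L%:R) ^+ 2)).
  by apply: le_of_eq; ring.
rewrite -[leRHS]mulrA ler_wpM2l//; apply: le_trans sqr_log_le.
by rewrite ler_sqr ?nnegrE// (le_trans _ Ln).
Qed.

Lemma sum_high_levels : \sum_(j < J | high_level j) (2 `^ (- (2 * tau))) ^+ j <=
  cutoff `^ (- (2 * tau)) / (1 - 2 `^ (- (2 * tau))).
Proof.
have Q0 : 0 < cutoff by exact: lt_le_trans cutoff_ge1.
have tt : 0 < 2 * tau by rewrite mulr_gt0.
have := energy_ratio_itv; set r := 2 `^ _ => r01.
apply: le_trans (geometric_tail J r01 (powR_ge0 _ _)).
rewrite big_mkcond [leRHS]big_mkcond; apply: ler_sum => j _.
have [h|_] := boolP (high_level j); last first.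
  by case: ifP => // _; rewrite exprn_ge0// ltW//; case/andP: r01.
rewrite ifT//; move: h => /andP[h _].
rewrite /r -powR_mulrn ?powR_ge0// powRAC powR_mulrn// -natrX !powRN.
by rewrite lef_pV2 ?posrE ?powR_gt0 ?ltr0n ?expn_gt0// ge0_ler_powR ?nnegrE ?(ltW tt) ?(ltW Q0) ?(ltW h).
Qed.

(** If some level is high then Q <= 2 N, which gives the comparison with N / n; if
    none is, the sum is empty. *)
Lemma sum_high_levels_le : M ^+ 2 * \sum_(j < J | high_level j) (2 `^ (- (2 * tau))) ^+ j <=
  2 * Num.min ((ncoord J d)%:R / n) besov_rate / (1 - 2 `^ (- (2 * tau))).
Proof.
have r1 : 0 < 1 - 2 `^ (- (2 * tau)) :> R.
  by rewrite subr_gt0; case/andP: energy_ratio_itv.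
have [/existsP[j hj]|no] := boolP [exists j : 'I_J, high_level j]; last first.
  rewrite big1 ?mulr0; last by move=> j hj; case/existsP: no; exists j.
  rewrite divr_ge0 ?(ltW r1)// mulr_ge0// le_min divr_ge0 ?(ltW n0)//.
  by rewrite ltW// besov_rate_gt0.
apply: (@le_trans _ _ (besov_rate / (1 - 2 `^ (- (2 * tau))))).
  by rewrite -cutoff_pow -mulrA ler_wpM2l ?sqr_ge0 ?sum_high_levels.
rewrite ler_wpM2r ?invr_ge0 ?(ltW r1)//.
(* Here Q = n * besov_rate < 2^j <= 2 d j <= 2 N for the high level j. *)
have x0 := besov_rate_gt0.
rewrite minr_pMr// le_min; apply/andP; split; last by move: x0; lra.
move: hj => /andP[h1 h2].
rewrite mulrA ler_pdivlMr// mulrC -/cutoff -natrM; apply: le_trans (ltW h1) _.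
rewrite ler_nat; apply: leq_trans (size_ge_half L0 dy (ltn_ord j) h2) _.
by rewrite leq_mul2l/= /ncoord (bigD1 j)//= leq_addr.
Qed.

Lemma sum_low_levels_le : \sum_(j < J | ~~ high_level j) (d j)%:R / n <=
  (4 + 16 * 17 * (2 * (1 + 2 * tau)) ^+ 2) * Num.min ((ncoord J d)%:R / n) besov_rate.
Proof.
have C1 : 1 <= 4 + 16 * 17 * (2 * (1 + 2 * tau)) ^+ 2.
  by have := sqr_ge0 (2 * (1 + 2 * tau)); set a := _ ^+ 2; lra.
rewrite minr_pMr ?(le_trans _ C1)// le_min -mulr_suml; apply/andP; split.
  rewrite mulrA ler_wpM2r ?invr_ge0 ?(ltW n0)//.
  apply: (@le_trans _ _ (ncoord J d)%:R); last by rewrite ler_peMl.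
  rewrite /ncoord natr_sum [leLHS]big_mkcond; apply: ler_sum => j _.
  by case: ifP.
rewrite ler_pdivrMr//; apply: le_trans sum_low_levels _.
by rewrite -[leRHS]mulrA [besov_rate * n]mulrC.
Qed.

(** With N <= n^2 the remainder N e / n is at most 1 / n <= Q / n. *)
Lemma exp_remainder_le (e : R) : 0 <= e -> e <= (n ^+ 2)^-1 ->
  (ncoord J d)%:R <= n ^+ 2 ->
  (ncoord J d)%:R / n * e <= Num.min ((ncoord J d)%:R / n) besov_rate.
Proof.
move=> e0 en Nn; have n2 : 0 < n ^+ 2 by rewrite exprn_gt0.
have Nn0 : 0 <= (ncoord J d)%:R / n by rewrite divr_ge0 ?(ltW n0).
rewrite le_min; apply/andP; split.
  rewrite ler_piMr// (le_trans en)// invf_le1//.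
  by rewrite exprn_ege1// ltW.
apply: le_trans (ler_wpM2l Nn0 en) _.
apply: (@le_trans _ _ n^-1).
  rewrite mulrAC -[leRHS]mul1r ler_wpM2r ?invr_ge0 ?(ltW n0)//.
  by rewrite ler_pdivrMr// mul1r.
by rewrite -[leLHS]mul1r ler_pdivrMr// mulrC cutoff_ge1.
Qed.

Lemma besov_high_energy (p q : R) (theta : coord_idx J d -> R) :
  2 <= p -> 1 <= q -> besov tau p q M theta ->
  \sum_(j < J | high_level j) \sum_(x | tag x == j) theta x ^+ 2 <=
  6 / (1 - 2 `^ (- (2 * tau))) * Num.min ((ncoord J d)%:R / n) besov_rate.
Proof.
move=> p2 q1 th.
apply: (@le_trans _ _ (3 * (M ^+ 2 * \sum_(j < J | high_level j) (2 `^ (- (2 * tau))) ^+ j))).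
  rewrite !mulr_sumr; apply: ler_sum => j /andP[_ hj].
  rewrite sum_tag; apply: besov_level_energy th => //.
  apply: (size_le_twice L0 dy _ hj); exact: ltn_ord.
have := sum_high_levels_le; set m := Num.min _ _; set S := M ^+ 2 * _ => h.
apply: (@le_trans _ _ (3 * (2 * m / (1 - 2 `^ (- (2 * tau)))))); last by apply: le_of_eq; ring.
by rewrite ler_wpM2l.
Qed.
End rate.

(** * Honest coverage and adaptive size *)

Theorem theorem5 (R : realType) (tau : R) (htau : 0 < tau) :
  exists C : R, 0 < C /\
  forall (disp : measure_display) (T : measurableType disp)
    (P : probability T R) (n alpha : R) (J : nat) (d : nat -> nat)
    (z : coord_idx J d -> {RV P >-> R}),
  1 < n -> 0 < alpha < 1 ->
  dyadic_sizes J (blocksize n) d ->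
  iid_std_normal z ->
  (ncoord J d)%:R <= n ^+ 2 ->
  ((1 - alpha - 2 / ln n)%:E <=
     ereal_inf [set P [set w | confidence_ball n alpha (obs n theta z w) theta]
               | theta in [set: coord_idx J d -> R]])%E
  /\
  (forall p q M : R, 2 <= p -> 1 <= q -> 1 <= M ->
    (ereal_sup [set 'E_P[fun w => radius2 n alpha (obs n theta z w)]
               | theta in besov (J := J) (d := d) tau p q M]
     <= ((2 * Num.sqrt (ln (2 / alpha))
            + 4 * Num.sqrt (lambda_star R) * normal_upper (alpha / 2) + 4)
           * Num.sqrt (ncoord J d)%:R / n
         + C * Num.min ((ncoord J d)%:R / n)
                 (M `^ (2 / (1 + 2 * tau))
                  * n `^ (- (2 * tau) / (1 + 2 * tau))))%:E)%E).
Proof.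
have [l1 lE] := lambda_starP R.
(* K1 is the charge of the radius for a kept block, C1 the constant for the low
   levels and C2 the one for the energy of the high levels. *)
pose lam := lambda_star R; pose K1 := 2 * lam + 8 * Num.sqrt lam - 1.
have lam1 : 1 < lam by [].
have K10 : 0 <= K1 by have := sqrtr_ge0 lam; rewrite /K1; move: lam1; lra.
have /andP[r0 r1] := energy_ratio_itv htau.
pose C1 := 4 + 16 * 17 * (2 * (1 + 2 * tau)) ^+ 2 : R.
pose C2 := 6 / (1 - 2 `^ (- (2 * tau))) : R.
have C10 : 0 < C1 by have := sqr_ge0 (2 * (1 + 2 * tau)); rewrite /C1; set a := _ ^+ 2; lra.
have C20 : 0 <= C2 by rewrite divr_ge0// subr_ge0 ltW.
pose K2 := 5 + K1 * ((lam - 1) / 2).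
have K20 : 0 <= K2.
  by rewrite addr_ge0// mulr_ge0// divr_ge0// subr_ge0 ltW.
exists ((lam + K1) * C1 + K2 * C2 + K1); split.
  have a1 : 0 < (lam + K1) * C1 by rewrite mulr_gt0// ltr_wpDr// (lt_trans _ lam1).
  have a2 := mulr_ge0 K20 C20.
  exact: ltr_wpDr (ltr_wpDr a2 a1).
move=> disp T P n alpha J d z n1 a01 dy iid Nn.
have n0 : 0 < n by exact: lt_trans n1.
have dL (j : 'I_J) : (blocksize n %| d j)%N by have [] := dy _ (ltn_ord j).
split.
  by apply: le_ereal_inf_tmp => _ [theta _ <-]; exact: coverage_ge.
move=> p q M p2 q1 M1; apply: ge_ereal_sup => _ [theta th <-].
have Ln : (blocksize n)%:R <= ln n + 1 by exact: ltW (blocksize_lt n1).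
have L0 := blocksize_gt0 n1.
pose hi (j : 'I_J) := high_level tau n M (blocksize n) j.
have dhi (j : 'I_J) : hi j -> (0 < d j)%N.
  move=> /andP[_ h]; have := size_ge_half L0 dy (ltn_ord j) h.
  by case: (d j) => //; rewrite muln0 leqn0 expn_eq0.
apply: le_trans (expected_radius2_le n1 dL iid theta a01 dhi) _.
rewrite lee_fin -/lam -/K1 -/K2.
set m := Num.min _ _.
have h1 := sum_low_levels_le htau n1 M1 Ln dy L0; rewrite -/C1 -/m in h1.
have h2 := besov_high_energy htau n1 M1 dy L0 p2 q1 th; rewrite -/C2 -/m in h2.
have h3 := exp_remainder_le htau n1 M1 (expR_ge0 _) (expR_blocksize_le n1) Nn; rewrite -/m in h3.
have h4 : \sum_(j | hi j) Num.sqrt (d j)%:R / n <= 4 * Num.sqrt (ncoord J d)%:R / n.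
  rewrite -mulr_suml ler_wpM2r ?invr_ge0 ?(ltW n0)//.
  apply: (@sum_sqrt_levels R _ _ _ L0 dy (high_level tau n M (blocksize n))).
    by move=> j /andP[].
  exact: high_level_succ.
have lK : 0 <= lam + K1 by rewrite addr_ge0// ltW// (lt_trans _ lam1).
have combine (A S a b c e f s1 s2 s3 s4 x : R) :
    s1 + s2 + s3 + s4 <= 4 * S / n + a * (e * x) + b * (f * x) + c * x ->
    A * S / n + s1 + s2 + s3 + s4 <= (A + 4) * S / n + (a * e + b * f + c) * x.
  rewrite -(lerD2l (A * S / n)) => h.
  have -> : A * S / n + s1 + s2 + s3 + s4 = A * S / n + (s1 + s2 + s3 + s4) by ring.
  by apply: le_trans h _; apply: le_of_eq; ring.
apply: combine.
exact: lerD (lerD (lerD h4 (ler_wpM2l lK h1)) (ler_wpM2l K20 h2)) (ler_wpM2l K10 h3).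
Qed.
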